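(* Let $\mathcal{D}$ be a convex domain in $\mathbb{H}$, and let $f:\mathcal{D}\to\mathbb{C}$ be polar-analytic on $\mathcal{D}$. Let $\gamma$ be a positively oriented, closed, regular curve in $\mathcal{D}$ that is the boundary of a convex domain $\operatorname{int}(\gamma)\subset\mathcal{D}$. Then, for $(r_0,\theta_0)\in\operatorname{int}(\gamma)$, $c\in\mathbb{R}$ and $k\in\mathbb{N}_0=\{0,1,2,\dots\}$, we have $$\frac{1}{2\pi i}\int_\gamma \frac{(re^{i\theta})^{c-1} f(r,\theta)\,e^{i\theta}}{\bigl(\log(r/r_0)+i(\theta-\theta_0)\bigr)^{k+1}}\,(dr+ir\,d\theta)=\bigl(r_0e^{i\theta_0}\bigr)^c\,\frac{(\widetilde{\Theta}_c^kf)(r_0,\theta_0)}{k!}.$$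
   Context: $\mathbb{H}:=\{(r,\theta): r\in\mathbb{R}^+,\ \theta\in\mathbb{R}\}$ with $\mathbb{R}^+=(0,\infty)$, regarded as an open subset of $\mathbb{R}^2$; a domain is a nonempty open connected subset. A function $f:\mathcal{D}\to\mathbb{C}$ on a domain $\mathcal{D}\subset\mathbb{H}$ is polar-analytic on $\mathcal{D}$ if for every $(r_0,\theta_0)\in\mathcal{D}$ the limit $$(D_{\rm pol}f)(r_0,\theta_0):=\lim_{(r,\theta)\to(r_0,\theta_0)}\frac{f(r,\theta)-f(r_0,\theta_0)}{re^{i\theta}-r_0e^{i\theta_0}}$$ exists. No periodicity in $\theta$ is assumed. For $c\in\mathbb{R}$, the polar Mellin derivative is $(\widetilde{\Theta}_cf)(r,\theta):=re^{i\theta}(D_{\rm pol}f)(r,\theta)+c f(r,\theta)$, and the higher order ones are $\widetilde{\Theta}_c^kf(r,\theta):=\sum_{j=0}^kS_c(k,j)\,r^je^{ij\theta}(D_{\rm pol}^jf)(r,\theta)$, where $D_{\rm pol}^j$ is the $j$-fold iterate of $D_{\rm pol}$ and $S_c(k,j)$ are the generalized Stirling numbers of the second kind given by $S_c(0,0)=1$, $S_c(k+1,j)=S_c(k,j-1)+(c+j)S_c(k,j)$, with $S_c(k,j)=0$ for $j<0$ or $j>k$. Equivalently, $\widetilde{\Theta}_c^k$ is the $k$-fold iterate of $\widetilde{\Theta}_c$, with $\widetilde{\Theta}_c^0f=f$. Powers are understood as $(re^{i\theta})^a:=r^ae^{ia\theta}$ for $a\in\mathbb{R}$, $(r,\theta)\in\mathbb{H}$.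 A closed regular curve is a simple closed piecewise continuously differentiable curve; positively oriented means counterclockwise in the $(r,\theta)$-plane. The integral is the line integral over $\gamma$ in the $(r,\theta)$-plane. *)

(* Defs.v *)
(* Points of the (r, theta)-plane and complex numbers are both pairs of reals;
   points are always typed [R * R], complex numbers [C].  A function on a domain D is
   represented by a total function, whose values off D are irrelevant: limits at points
   of an open D, and integrals along curves in D, only see the values on D. *)
From Stdlib Require Import Reals.
From Coquelicot Require Import Coquelicot.
Open Scope R_scope.

Definition nonempty (U : R * R -> Prop) : Prop := exists p, U p.

Definition contained (U V : R * R -> Prop) : Prop := forall p, U p -> V p.

Definition connected (U : R * R -> Prop) : Prop :=
  forall A B : R * R -> Prop, open A -> open B ->
    (forall p, U p -> A p \/ B p) ->
    (exists p, U p /\ A p) -> (exists p, U p /\ B p) ->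
    exists p, U p /\ A p /\ B p.

Definition is_domain (U : R * R -> Prop) : Prop :=
  nonempty U /\ open U /\ connected U.

Definition convex (U : R * R -> Prop) : Prop :=
  forall p q : R * R, U p -> U q -> forall s : R, 0 <= s <= 1 ->
    U ((1 - s) * fst p + s * fst q, (1 - s) * snd p + s * snd q).

Definition boundary (U : R * R -> Prop) (p : R * R) : Prop :=
  forall V : R * R -> Prop, locally p V ->
    (exists q, V q /\ U q) /\ (exists q, V q /\ ~ U q).

Definition Hpolar (p : R * R) : Prop := 0 < fst p.

(* e^{i theta} *)
Definition cis (theta : R) : C := (cos theta, sin theta).

(* (r e^{i theta})^a = r^a e^{i a theta}, theta not being reduced modulo 2 pi *)
Definition polar_power (a : R) (p : R * R) : C :=
  (RtoC (Rpower (fst p) a) * cis (a * snd p))%C.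

Definition polar_point (p : R * R) : C := (RtoC (fst p) * cis (snd p))%C.

Definition is_Dpol (f : R * R -> C) (p : R * R) (l : C) : Prop :=
  filterlim (fun q : R * R => ((f q - f p) / (polar_point q - polar_point p))%C)
    (locally' p) (locally (T := C_UniformSpace) l).

Definition polar_analytic (D : R * R -> Prop) (f : R * R -> C) : Prop :=
  forall p, D p -> exists l : C, is_Dpol f p l.

(* Total operator: the limit when it exists, an unspecified value otherwise. *)
Definition Dpol (f : R * R -> C) (p : R * R) : C :=
  iota (T := C_R_CompleteNormedModule) (is_Dpol f p).

Definition Dpol_n (j : nat) (f : R * R -> C) : R * R -> C := Nat.iter j Dpol f.

(* S_c(k, j), generalized Stirling numbers of the second kind. *)
Fixpoint Stirling (c : R) (k j : nat) : R :=
  match k, j with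
  | O, O => 1
  | O, S _ => 0
  | S k', O => c * Stirling c k' O
  | S k', S j' => Stirling c k' j' + (c + INR j) * Stirling c k' j
  end.

(* Polar Mellin derivative of order k, which is also the k-fold iterate of
   f |-> (r e^{i theta} Dpol f + c f). *)
Definition Theta (c : R) (k : nat) (f : R * R -> C) (p : R * R) : C :=
  sum_n (G := C_AbelianGroup)
    (fun j : nat =>
       (RtoC (Stirling c k j) *
        (RtoC (fst p ^ j) * cis (INR j * snd p)) * Dpol_n j f p)%C) k.

(* On every piece [t i, t (i+1)] the function coincides with one that is C^1 on the
   whole line, i.e. it is C^1 up to the endpoints, with one-sided derivatives there. *)
Definition piecewise_C1 (x : R -> R) (a b : R) : Prop :=
  exists (n : nat) (t : nat -> R),
    t O = a /\ t n = b /\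
    (forall i, (i < n)%nat -> t i < t (S i)) /\
    (forall i, (i < n)%nat -> exists g : R -> R,
        (forall s, ex_derive g s) /\ (forall s, continuous (Derive g) s) /\
        (forall s, t i <= s <= t (S i) -> x s = g s)).

Definition closed_regular_curve (gamma : R -> R * R) (a b : R) : Prop :=
  a < b /\
  piecewise_C1 (fun t => fst (gamma t)) a b /\
  piecewise_C1 (fun t => snd (gamma t)) a b /\
  gamma a = gamma b /\
  (forall s t, a <= s < b -> a <= t < b -> gamma s = gamma t -> s = t).

Definition trace (gamma : R -> R * R) (a b : R) (p : R * R) : Prop :=
  exists t, a <= t <= b /\ gamma t = p.

(* Integral of P dr + Q dtheta along gamma.  For a piecewise C^1 curve, the finitely
   many points where [Derive] is meaningless do not affect the integral. *)
Definition line_integral (gamma : R -> R * R) (a b : R) (P Q : R * R -> C) : C :=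
  RInt (V := C_R_CompleteNormedModule)
    (fun t : R =>
       (P (gamma t) * RtoC (Derive (fun s => fst (gamma s)) t) +
        Q (gamma t) * RtoC (Derive (fun s => snd (gamma s)) t))%C) a b.

(* Winding number of gamma about p, with (r, theta) identified with r + i theta. *)
Definition winding_number (gamma : R -> R * R) (a b : R) (p : R * R) : C :=
  (/ (2 * PI * Ci) *
   line_integral gamma a b
     (fun q => / ((fst q - fst p)%R + Ci * (snd q - snd p)%R))
     (fun q => Ci / ((fst q - fst p)%R + Ci * (snd q - snd p)%R)))%C.

(* gamma runs counterclockwise, once, around each point of the region U it bounds. *)
Definition positively_oriented (gamma : R -> R * R) (a b : R)
    (U : R * R -> Prop) : Prop :=
  forall p, U p -> winding_number gamma a b p = RtoC 1.

(* Main.v *)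
(* The coordinate Llog (r, theta) = ln r + i theta turns polar-analytic functions into
   holomorphic ones: with h = (r e^{i theta})^c f the integrand is
   h dLlog / (Llog - Llog p0)^(k+1), and the derivative with respect to Llog of
   (r e^{i theta})^c g is (r e^{i theta})^c Theta_c g.  So the claim is Cauchy's formula for
   the k-th derivative of h in the variable Llog.

   The image of D under Llog need not be convex, so Goursat's lemma is proved for the form
   phi dLlog on straight triangles of the (r, theta)-plane.  Allowing one exceptional point p
   where phi is only continuous, it gives a primitive of (h - h p) / (Llog - Llog p) dLlog,
   hence 2 pi i h(p) = int_gamma h dLlog / (Llog - Llog p), once the winding number in the
   variable Llog is known.  It agrees with the one in the variable z = r + i theta since
   (Llog q - Llog p) / (z q - z p) has positive real part and therefore a continuous logarithm.
   The formula holds at every p in U, so it may be differentiated k times under the integral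
   sign; this also shows that the iterated polar derivatives of f exist. *)
Require Import Defs.
From Stdlib Require Import Reals Factorial Lra Lia Psatz Classical ClassicalEpsilon.
From Coquelicot Require Import Coquelicot.
Open Scope R_scope.

(** * Complex-valued continuity and differentiation *)

(** Plane points are typed [C] from here on, which is convertible with [R * R]: [Cmod] then serves
    as Euclidean distance and [ring] treats affine combinations. Differentiability in a coordinate
    [L] is put in Carathéodory's form ([cdiff]), where product, inverse and change-of-coordinate
    rules are algebra on slope functions; it suits [Llog] as well as [polar_point], which is only
    locally injective. Integration sees a potential only through its derivative along differentiable
    curves ([is_differential]).

    The delicate point at the end is that [Dpol] is a total operator, unspecified where no limit
    exists, while [f] is only assumed to have a first derivative. With G_n the successive
    [Llog]-derivatives of h on U given by Cauchy integrals, the functions E_n = (r e^{i theta})^{-c}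
    G_n satisfy E_0 = f and dE_n/dLlog = E_{n+1} - c E_n there. So each iterate of [Dpol] on f is,
    on U, a finite combination of products of some E_n with a power, hence differentiable again, and
    the Stirling recurrence identifies [Theta c k f] with E_k. *)

Notation ccontinuous := (continuous (U := C_UniformSpace)).
Notation is_cderive := (is_derive (K := R_AbsRing) (V := C_R_NormedModule)).
Notation is_CInt := (is_RInt (V := C_R_NormedModule)).
Notation CInt := (RInt (V := C_R_CompleteNormedModule)).
Notation ex_CInt := (ex_RInt (V := C_R_NormedModule)).

(* Equations stated in a Coquelicot structure on C escape [ring] and [field]. *)
Ltac as_C := match goal with |- ?x = ?y => change (@eq C x y) end.

Lemma C_surjective (z : C) : z = (fst z, snd z).
Proof. now destruct z. Qed.

Lemma Cnorm_R (z : C) : norm (V := C_R_NormedModule) z = Cmod z.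
Proof.
  destruct z as [x y]; unfold norm; simpl; unfold prod_norm; simpl.
  unfold Cmod, norm; simpl; unfold abs; simpl.
  f_equal. rewrite 2 Rmult_1_r.
  rewrite <- 2 Rabs_mult. unfold Rsqr. 
  rewrite 2 Rabs_pos_eq; nra.
Qed.

Lemma Cmod_sym (z w : C) : Cmod (z - w) = Cmod (w - z).
Proof. rewrite <- Cmod_opp. f_equal. ring. Qed.

Lemma Cmod_le_sum (z : C) : Cmod z <= Rabs (fst z) + Rabs (snd z).
Proof.
  rewrite (C_surjective z) at 1.
  replace (fst z, snd z) with (RtoC (fst z) + Ci * RtoC (snd z))%C
    by (apply injective_projections; simpl; ring).
  eapply Rle_trans; [apply Cmod_triangle|].
  rewrite Cmod_mult, !Cmod_R, Cmod_Ci. lra.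
Qed.

Lemma Rabs_fst_le (z : C) : Rabs (fst z) <= Cmod z.
Proof. apply re_le_Cmod. Qed.

Lemma Rabs_snd_le (z : C) : Rabs (snd z) <= Cmod z.
Proof. eapply Rle_trans; [apply Rmax_r| apply Rmax_Cmod]. Qed.

Lemma Cmod_triangle_sub (z w : C) : Cmod z - Cmod w <= Cmod (z - w).
Proof.
  assert (Cmod z <= Cmod (z - w) + Cmod w); [|lra].
  replace z with ((z - w) + w)%C at 1 by ring. apply Cmod_triangle.
Qed.

(** Neighbourhoods in the product uniform structure are boxes in the two coordinates; a disc lies in
    the box of the same radius and contains the box of half that radius. *)
Lemma locally_Cmod (p : C) (V : C -> Prop) :
  locally (T := C_UniformSpace) p V <->
  exists d, 0 < d /\ forall q, Cmod (q - p) < d -> V q.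
Proof.
  split.
  - intros [d Hd]. exists d. split; [apply d|].
    intros q Hq. apply Hd.
    split; simpl; unfold AbsRing_ball, abs, minus, plus, opp; simpl.
    + eapply Rle_lt_trans; [|exact Hq]. apply (Rabs_fst_le (q - p)).
    + eapply Rle_lt_trans; [|exact Hq]. apply (Rabs_snd_le (q - p)).
  - intros [d [d0 Hd]]. assert (d2 : 0 < d / 2) by lra. exists (mkposreal _ d2).
    intros q [H1 H2].
    change (Rabs (fst q - fst p) < d / 2) in H1.
    change (Rabs (snd q - snd p) < d / 2) in H2.
    apply Hd. eapply Rle_lt_trans; [apply Cmod_le_sum|]. 
    change (Rabs (fst q - fst p) + Rabs (snd q - snd p) < d). lra.
Qed.

Lemma ccontinuous_eps (f : C -> C) (p : C) :
  ccontinuous f p <->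
  forall e, 0 < e -> exists d, 0 < d /\
    forall q, Cmod (q - p) < d -> Cmod (f q - f p) < e.
Proof.
  split.
  - intros H e e0.
    apply (locally_Cmod p (fun q => Cmod (f q - f p) < e)).
    apply (H (fun w => Cmod (w - f p) < e)). apply locally_Cmod. now exists e.
  - intros H V HV. apply locally_Cmod in HV. destruct HV as [e [e0 He]].
    destruct (H e e0) as [d [d0 Hd]].
    apply locally_Cmod. exists d. split; auto.
Qed.

Lemma ccontinuous_eps_R (f : R -> C) (t : R) :
  ccontinuous f t <->
  forall e, 0 < e -> exists d, 0 < d /\
    forall s, Rabs (s - t) < d -> Cmod (f s - f t) < e.
Proof.
  split.
  - intros H e e0.
    destruct (H (fun z => Cmod (z - f t) < e)) as [d Hd].
    { apply locally_Cmod. now exists e. }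
    exists d. split; [apply d|]. intros s Hs. apply Hd. exact Hs.
  - intros H V HV. apply locally_Cmod in HV. destruct HV as [e [e0 He]].
    destruct (H e e0) as [d [d0 Hd]].
    exists (mkposreal d d0). intros s Hs. apply He, Hd. exact Hs.
Qed.

Section Components.
Context {T : UniformSpace}.
Implicit Types f g : T -> C.

Lemma ccontinuous_pair (u v : T -> R) x :
  continuous u x -> continuous v x -> ccontinuous (fun t => (u t, v t)) x.
Proof.
  intros Hu Hv.
  apply (filterlim_locally (U := C_UniformSpace)). intros e.
  generalize (proj1 (filterlim_locally _ _) Hu e) (proj1 (filterlim_locally _ _) Hv e).
  intros A B. generalize (filter_and _ _ A B). apply filter_imp.
  intros t [H1 H2]. split; assumption.
Qed.

Lemma ccontinuous_fst f x : ccontinuous f x -> continuous (fun t => fst (f t)) x.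
Proof.
  intros H. apply filterlim_locally. intros e.
  generalize (proj1 (filterlim_locally (U := C_UniformSpace) _ _) H e).
  apply filter_imp. intros t [H1 H2]; assumption.
Qed.

Lemma ccontinuous_snd f x : ccontinuous f x -> continuous (fun t => snd (f t)) x.
Proof.
  intros H. apply filterlim_locally. intros e.
  generalize (proj1 (filterlim_locally (U := C_UniformSpace) _ _) H e).
  apply filter_imp. intros t [H1 H2]; assumption.
Qed.

Lemma ccontinuous_ext_loc f g x :
  locally x (fun t => f t = g t) -> ccontinuous f x -> ccontinuous g x.
Proof.
  intros H Hf. unfold continuous. rewrite <- (locally_singleton _ _ H).
  eapply filterlim_ext_loc; [exact H|exact Hf].
Qed.

Lemma ccontinuous_const (c : C) x : ccontinuous (fun _ : T => c) x.
Proof. apply continuous_const. Qed.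

Lemma ccontinuous_plus f g x :
  ccontinuous f x -> ccontinuous g x -> ccontinuous (fun t => (f t + g t)%C) x.
Proof.
  intros Hf Hg. apply ccontinuous_pair.
  - apply (continuous_plus (fun t => fst (f t)) (fun t => fst (g t)));
      now apply ccontinuous_fst.
  - apply (continuous_plus (fun t => snd (f t)) (fun t => snd (g t)));
      now apply ccontinuous_snd.
Qed.

Lemma ccontinuous_opp f x : ccontinuous f x -> ccontinuous (fun t => (- f t)%C) x.
Proof.
  intros Hf. apply ccontinuous_pair.
  - apply (continuous_opp (fun t => fst (f t))). now apply ccontinuous_fst.
  - apply (continuous_opp (fun t => snd (f t))). now apply ccontinuous_snd.
Qed.

Lemma ccontinuous_minus f g x :
  ccontinuous f x -> ccontinuous g x -> ccontinuous (fun t => (f t - g t)%C) x.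
Proof. intros Hf Hg. apply ccontinuous_plus; [easy|now apply ccontinuous_opp]. Qed.

Lemma ccontinuous_mult f g x :
  ccontinuous f x -> ccontinuous g x -> ccontinuous (fun t => (f t * g t)%C) x.
Proof.
  intros Hf Hg.
  pose proof (ccontinuous_fst _ _ Hf). pose proof (ccontinuous_snd _ _ Hf).
  pose proof (ccontinuous_fst _ _ Hg). pose proof (ccontinuous_snd _ _ Hg).
  apply ccontinuous_pair.
  - apply (continuous_minus (fun t => fst (f t) * fst (g t)) (fun t => snd (f t) * snd (g t)));
    now apply (continuous_mult (K := R_AbsRing)).
  - apply (continuous_plus (fun t => fst (f t) * snd (g t)) (fun t => snd (f t) * fst (g t)));
    now apply (continuous_mult (K := R_AbsRing)).
Qed.

Lemma ccontinuous_RtoC (u : T -> R) x :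
  continuous u x -> ccontinuous (fun t => RtoC (u t)) x.
Proof. intros. apply ccontinuous_pair; [easy|apply continuous_const]. Qed.

Lemma ccontinuous_inv f x :
  f x <> 0 -> ccontinuous f x -> ccontinuous (fun t => (/ f t)%C) x.
Proof.
  intros N Hf.
  pose proof (ccontinuous_fst _ _ Hf) as H1. pose proof (ccontinuous_snd _ _ Hf) as H2.
  set (n := fun t => fst (f t) ^ 2 + snd (f t) ^ 2).
  assert (Hn : continuous (fun t => / n t) x).
  { apply (continuous_comp n Rinv).
    - unfold n. apply (continuous_plus (fun t => fst (f t) ^ 2) (fun t => snd (f t) ^ 2)).
      + apply (continuous_comp (fun t => fst (f t)) (fun r => r ^ 2)); [easy|].
        apply (ex_derive_continuous (fun r => r ^ 2)). auto_derive; easy.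
      + apply (continuous_comp (fun t => snd (f t)) (fun r => r ^ 2)); [easy|].
        apply (ex_derive_continuous (fun r => r ^ 2)). auto_derive; easy.
    - apply continuous_Rinv. unfold n. intros E. apply N.
      apply injective_projections; simpl; nra. }
  apply ccontinuous_pair.
  - now apply (continuous_mult (K := R_AbsRing)).
  - apply (continuous_mult (K := R_AbsRing) (fun t => - snd (f t))); [|easy].
    now apply (continuous_opp (fun t => snd (f t))).
Qed.

Lemma ccontinuous_div f g x :
  g x <> 0 -> ccontinuous f x -> ccontinuous g x -> ccontinuous (fun t => (f t / g t)%C) x.
Proof. intros. apply ccontinuous_mult; [easy|now apply ccontinuous_inv]. Qed.

Lemma ccontinuous_pow f n x :
  ccontinuous f x -> ccontinuous (fun t => (f t ^ n)%C) x.
Proof.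
  intros H. induction n; simpl; [apply ccontinuous_const|now apply ccontinuous_mult].
Qed.

End Components.

Lemma is_cderive_pair (u v : R -> R) t lu lv :
  is_derive u t lu -> is_derive v t lv -> is_cderive (fun s => (u s, v s)) t (lu, lv).
Proof.
  intros Hu Hv.
  apply (is_derive_ext (V := C_R_NormedModule) (fun s => plus (scal (u s) (1, 0) : C_R_NormedModule) (scal (v s) ((0, 1) : C_R_NormedModule)))).
  { intros s. apply injective_projections; simpl;
      unfold plus, scal; simpl; unfold mult; simpl; ring. }
  replace (lu, lv) with
    (plus (scal lu ((1, 0) : C_R_NormedModule)) (scal lv ((0, 1) : C_R_NormedModule))).
  2:{ apply injective_projections; simpl;
      unfold plus, scal; simpl; unfold mult; simpl; ring. }
  apply (is_derive_plus (V := C_R_NormedModule)).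
  - now apply (is_derive_scal_l (V := C_R_NormedModule) u).
  - now apply (is_derive_scal_l (V := C_R_NormedModule) v).
Qed.

Lemma is_derive_slope (u s : R -> R) t :
  locally t (fun x => u x - u t = (x - t) * s x) -> continuous s t ->
  is_derive u t (s t).
Proof.
  intros [d Hd] Hs. apply is_derive_Reals. intros e e0.
  destruct (proj1 (filterlim_locally _ _) Hs (mkposreal e e0)) as [d' Hd'].
  exists (mkposreal _ (Rmin_pos d d' (cond_pos d) (cond_pos d'))). intros h h0 Hh. simpl in Hh.
  assert (Eh : t + h + - t = h) by ring.
  assert (B1 : ball t d (t + h)).
  { unfold ball; simpl; unfold AbsRing_ball, abs, minus, plus, opp; simpl.
    eapply Rle_lt_trans; [right; apply (f_equal Rabs Eh)|]. eapply Rlt_le_trans; [exact Hh|apply Rmin_l]. }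
  assert (B2 : ball t d' (t + h)).
  { unfold ball; simpl; unfold AbsRing_ball, abs, minus, plus, opp; simpl.
    eapply Rle_lt_trans; [right; apply (f_equal Rabs Eh)|]. eapply Rlt_le_trans; [exact Hh|apply Rmin_r]. }
  rewrite (Hd _ B1). replace ((t + h - t) * s (t + h) / h) with (s (t + h)) by (field; easy).
  exact (Hd' _ B2).
Qed.

(** Carathéodory's slope function: the difference quotient completed by the derivative at [t]. The
    resulting identity holds at every [x], so later arguments never divide by [x - t]. *)
Lemma slope_of_derive (u : R -> R) t l :
  is_derive u t l ->
  exists s, continuous s t /\ s t = l /\ forall x, u x - u t = (x - t) * s x.
Proof.
  intros H. apply is_derive_Reals in H.
  exists (fun x => if Req_EM_T x t then l else (u x - u t) / (x - t)).
  split; [|split].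
  - apply filterlim_locally. intros e. destruct (H e (cond_pos e)) as [d Hd].
    exists d. intros x Hx. unfold ball; simpl; unfold AbsRing_ball, abs, minus, plus, opp; simpl.
    destruct (Req_EM_T t t) as [_|?]; [|easy].
    destruct (Req_EM_T x t) as [->|N].
    + rewrite Rplus_opp_r, Rabs_R0. apply cond_pos.
    + specialize (Hd (x - t)). rewrite (Rplus_minus t x : t + (x - t) = x) in Hd.
      apply Hd; [lra|exact Hx].
  - destruct (Req_EM_T t t); easy.
  - intros x. destruct (Req_EM_T x t) as [->|N]; [ring|]. field. lra.
Qed.

Lemma is_cderive_slope (f s : R -> C) t :
  locally t (fun x => (f x - f t)%C = ((x - t)%R * s x)%C) -> ccontinuous s t ->
  is_cderive f t (s t).
Proof.
  intros H Hs. rewrite (C_surjective (s t)).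
  apply (is_derive_ext (V := C_R_NormedModule) (fun x => (fst (f x), snd (f x)))).
  { intros x. symmetry. apply C_surjective. }
  apply is_cderive_pair.
  - apply (is_derive_slope (fun x => fst (f x)) (fun x => fst (s x))).
    + revert H. apply filter_imp. intros x E. apply (f_equal fst) in E. simpl in E.
      unfold Rminus. rewrite E. ring.
    + now apply ccontinuous_fst.
  - apply (is_derive_slope (fun x => snd (f x)) (fun x => snd (s x))).
    + revert H. apply filter_imp. intros x E. apply (f_equal snd) in E. simpl in E.
      unfold Rminus. rewrite E. ring.
    + now apply ccontinuous_snd.
Qed.

(** * Derivatives with respect to a complex coordinate *)

(** Carathéodory's form of df/dL = l at [p]. It stays meaningful where [L q = L p] for some [q] near
    [p], and lets the coordinate itself be changed, since [L] is an arbitrary function. *)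
Definition cdiff (L f : C -> C) (p l : C) : Prop :=
  exists rho : C -> C,
    locally (T := C_UniformSpace) p (fun q => (f q - f p)%C = (rho q * (L q - L p))%C) /\
    ccontinuous rho p /\ rho p = l.

Section Rules.
Implicit Types (L M f g : C -> C) (p q l m n k : C).

Lemma cdiff_const L k p : cdiff L (fun _ => k) p 0.
Proof.
  exists (fun _ => RtoC 0). split; [|split; [apply ccontinuous_const|easy]].
  apply filter_forall. intros q. ring.
Qed.

Lemma cdiff_self L p : cdiff L L p 1.
Proof.
  exists (fun _ => RtoC 1). split; [|split; [apply ccontinuous_const|easy]].
  apply filter_forall. intros q. ring.
Qed.

Lemma cdiff_ext_loc L f g p l :
  locally (T := C_UniformSpace) p (fun q => f q = g q) -> cdiff L f p l -> cdiff L g p l.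
Proof.
  intros E [rho [H1 H2]]. exists rho. split; [|easy].
  rewrite <- (locally_singleton _ _ E).
  generalize (filter_and _ _ E H1). apply filter_imp. intros q [<- Hq]; easy.
Qed.

Lemma cdiff_ext L f g p l :
  (forall q, f q = g q) -> cdiff L f p l -> cdiff L g p l.
Proof. intros E. apply cdiff_ext_loc. now apply filter_forall. Qed.

Lemma cdiff_plus L f g p l m :
  cdiff L f p l -> cdiff L g p m -> cdiff L (fun q => f q + g q)%C p (l + m).
Proof.
  intros [r [H1 [H2 H3]]] [s [K1 [K2 K3]]].
  exists (fun q => r q + s q)%C. split; [|split].
  - generalize (filter_and _ _ H1 K1). apply filter_imp. intros q [E1 E2].
    replace (f q + g q - (f p + g p))%C with ((f q - f p) + (g q - g p))%C by ring.
    rewrite E1, E2. ring.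
  - now apply ccontinuous_plus.
  - now rewrite H3, K3.
Qed.

Lemma cdiff_continuous L f p l : ccontinuous L p -> cdiff L f p l -> ccontinuous f p.
Proof.
  intros HL [r [H1 [H2 H3]]].
  apply (ccontinuous_ext_loc (fun q => f p + r q * (L q - L p))%C).
  - revert H1. apply filter_imp. intros q E. rewrite <- E. ring.
  - apply ccontinuous_plus; [apply ccontinuous_const|].
    apply ccontinuous_mult; [easy|].
    apply ccontinuous_minus; [easy|apply ccontinuous_const].
Qed.

Lemma cdiff_mult L f g p l m : ccontinuous L p ->
  cdiff L f p l -> cdiff L g p m -> cdiff L (fun q => f q * g q)%C p (l * g p + f p * m).
Proof.
  intros HL Hf Hg.
  pose proof (cdiff_continuous _ _ _ _ HL Hg) as Cg.
  destruct Hf as [r [H1 [H2 H3]]]. destruct Hg as [s [K1 [K2 K3]]].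
  exists (fun q => r q * g q + f p * s q)%C. split; [|split].
  - generalize (filter_and _ _ H1 K1). apply filter_imp. intros q [E1 E2].
    replace (f q * g q - f p * g p)%C
      with ((f q - f p) * g q + f p * (g q - g p))%C by ring.
    rewrite E1, E2. ring.
  - apply ccontinuous_plus; apply ccontinuous_mult; try easy. apply ccontinuous_const.
  - now rewrite H3, K3.
Qed.

Lemma cdiff_scal L f p l k : ccontinuous L p ->
  cdiff L f p l -> cdiff L (fun q => k * f q)%C p (k * l).
Proof.
  intros HL Hf.
  replace (k * l)%C with (0 * f p + k * l)%C by ring.
  apply (cdiff_mult L (fun _ => k)); [easy|apply cdiff_const|easy].
Qed.

Lemma ccontinuous_neq (f : C -> C) p :
  ccontinuous f p -> f p <> 0 -> locally (T := C_UniformSpace) p (fun q => f q <> 0).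
Proof.
  intros Hf N. apply Cmod_gt_0 in N.
  destruct (proj1 (ccontinuous_eps f p) Hf _ N) as [d [d0 Hd]].
  apply locally_Cmod. exists d. split; [easy|]. intros q Hq E.
  specialize (Hd q Hq). rewrite E in Hd.
  replace (0 - f p)%C with (- f p)%C in Hd by ring. rewrite Cmod_opp in Hd. lra.
Qed.

Lemma cdiff_inv L f p l : ccontinuous L p -> f p <> 0 ->
  cdiff L f p l -> cdiff L (fun q => / f q)%C p (- l / (f p * f p)).
Proof.
  intros HL N Hf.
  pose proof (cdiff_continuous _ _ _ _ HL Hf) as Cf.
  destruct Hf as [r [H1 [H2 H3]]].
  exists (fun q => - r q / (f q * f p))%C. split; [|split].
  - generalize (filter_and _ _ H1 (ccontinuous_neq _ _ Cf N)).
    apply filter_imp. intros q [E1 E2].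
    replace (/ f q - / f p)%C with (- (f q - f p) / (f q * f p))%C by (field; easy).
    rewrite E1. field. easy.
  - apply ccontinuous_div.
    + now apply Cmult_neq_0.
    + now apply ccontinuous_opp.
    + apply ccontinuous_mult; [easy|apply ccontinuous_const].
  - now rewrite H3.
Qed.

Lemma cdiff_comp L M f p m n : ccontinuous M p ->
  cdiff L f p m -> cdiff M L p n -> cdiff M f p (m * n).
Proof.
  intros HM [r [H1 [H2 H3]]] [s [K1 [K2 K3]]].
  exists (fun q => r q * s q)%C. split; [|split].
  - generalize (filter_and _ _ H1 K1). apply filter_imp. intros q [E1 E2].
    rewrite E1, E2. ring.
  - now apply ccontinuous_mult.
  - now rewrite H3, K3.
Qed.

(** Exchanging coordinate and function inverts the slope, which is nonzero near [p] by continuity;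
    no inverse function is constructed. *)
Lemma cdiff_inverse L M p m : m <> 0 -> cdiff M L p m -> cdiff L M p (/ m).
Proof.
  intros N [s [K1 [K2 K3]]]. rewrite <- K3 in N.
  exists (fun q => / s q)%C. split; [|split].
  - generalize (filter_and _ _ K1 (ccontinuous_neq _ _ K2 N)).
    apply filter_imp. intros q [E1 E2].
    rewrite E1. field. easy.
  - now apply ccontinuous_inv.
  - now rewrite K3.
Qed.

Lemma cdiff_of_error L f p l :
  (forall e, 0 < e -> locally (T := C_UniformSpace) p
     (fun q => Cmod (f q - f p - l * (L q - L p)) <= e * Cmod (L q - L p))) ->
  cdiff L f p l.
Proof.
  intros H.
  exists (fun q => if Ceq_dec (L q - L p) 0 then l else (f q - f p) / (L q - L p))%C.
  split; [|split].
  (* Any fixed [e] would do: where [L q = L p] the estimate forces [f q = f p], so the filler value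
     [l] is harmless; elsewhere the quotient is exact. *)
  - specialize (H 1 Rlt_0_1). revert H. apply filter_imp. intros q Hq.
    destruct (Ceq_dec (L q - L p) 0) as [E|N].
    + rewrite E in *. rewrite !Cmult_0_r, Cmod_0, Rmult_0_r in *.
      apply Cmod_eq_0. apply Rle_antisym; [|apply Cmod_ge_0].
      now replace (f q - f p)%C with (f q - f p - 0)%C by ring.
    + field. easy.
  - apply ccontinuous_eps. intros e e0.
    assert (e2 : 0 < e / 2) by lra.
    destruct (proj1 (locally_Cmod _ _) (H _ e2)) as [d [d0 Hd]].
    exists d. split; [easy|]. intros q Hq. specialize (Hd q Hq).
    destruct (Ceq_dec (L p - L p) 0) as [_|N].
    2:{ exfalso. apply N. ring. }
    destruct (Ceq_dec (L q - L p) 0) as [E|N].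
    + replace (l - l)%C with (RtoC 0) by ring. now rewrite Cmod_0.
    + replace ((f q - f p) / (L q - L p) - l)%C
        with ((f q - f p - l * (L q - L p)) / (L q - L p))%C by (field; easy).
      rewrite Cmod_div by easy. apply Cmod_gt_0 in N.
      apply (Rle_lt_trans _ (e / 2)); [|lra].
      apply (Rmult_le_reg_r (Cmod (L q - L p))); [easy|].
      unfold Rdiv at 1. rewrite Rmult_assoc, Rinv_l, Rmult_1_r; lra.
  - destruct (Ceq_dec (L p - L p) 0) as [_|N]; [easy|]. exfalso. apply N. ring.
Qed.

(** If [L] were constant near [p], every slope would fit; points arbitrarily near [p] where [L]
    differs from [L p] pin the value down by continuity. *)
Lemma cdiff_unique L f p l m :
  (forall d, 0 < d -> exists q, Cmod (q - p) < d /\ L q <> L p) ->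
  cdiff L f p l -> cdiff L f p m -> l = m.
Proof.
  intros HL [r [H1 [H2 H3]]] [s [K1 [K2 K3]]].
  destruct (Ceq_dec (r p - s p) 0) as [E|N].
  { rewrite <- H3, <- K3. replace (r p) with (r p - s p + s p)%C by ring. rewrite E. ring. }
  exfalso.
  pose proof (ccontinuous_neq (fun q => r q - s q)%C p (ccontinuous_minus _ _ _ H2 K2) N) as Q.
  destruct (proj1 (locally_Cmod _ _) (filter_and _ _ Q (filter_and _ _ H1 K1))) as [d [d0 Hd]].
  destruct (HL d d0) as [q [Hq Nq]]. destruct (Hd q Hq) as [N' [E1 E2]].
  apply N'. rewrite E1 in E2.
  assert (L q - L p <> 0)%C.
  { intros E. apply Nq. replace (L q) with (L q - L p + L p)%C by ring. rewrite E. ring. }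
  replace (r q - s q)%C with ((r q * (L q - L p) - s q * (L q - L p)) / (L q - L p))%C
    by (field; easy).
  rewrite E2. field. easy.
Qed.

End Rules.

(** * The coordinate [Llog], the complex exponential, and powers of r e^{i theta} as functions of
    [Llog] *)

Definition Llog (p : C) : C := (ln (fst p), snd p).

Lemma locally_fst_pos (p : C) : 0 < fst p ->
  locally (T := C_UniformSpace) p (fun q => 0 < fst q).
Proof.
  intros H. apply locally_Cmod. exists (fst p). split; [easy|]. intros q Hq.
  pose proof (Rabs_fst_le (q - p)) as K. simpl in K.
  assert (Rabs (fst q + - fst p) < fst p) as A by lra. apply Rabs_def2 in A. lra.
Qed.

Lemma Llog_continuous (p : C) : 0 < fst p -> ccontinuous Llog p.
Proof.
  intros H. apply ccontinuous_pair.
  - apply (continuous_comp (U := C_UniformSpace) fst ln).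
    + apply (continuous_fst (U := R_UniformSpace) (V := R_UniformSpace)).
    + now apply continuous_ln.
  - apply (continuous_snd (U := R_UniformSpace) (V := R_UniformSpace)).
Qed.

Lemma Llog_inj (p q : C) : 0 < fst p -> 0 < fst q -> Llog p = Llog q -> p = q.
Proof.
  intros Hp Hq E. injection E. intros E2 E1.
  apply injective_projections; [now apply ln_inv|easy].
Qed.

Lemma Llog_nonconst (p : C) : 0 < fst p ->
  forall d, 0 < d -> exists q, Cmod (q - p) < d /\ Llog q <> Llog p.
Proof.
  intros Hp d d0. exists (fst p + d / 2, snd p). split.
  - eapply Rle_lt_trans; [apply Cmod_le_sum|]. simpl.
    replace (fst p + d / 2 + - fst p) with (d / 2) by ring.
    rewrite Rplus_opp_r, Rabs_R0, Rabs_pos_eq; lra.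
  - intros E. apply Llog_inj in E; simpl; try lra.
    apply (f_equal fst) in E. simpl in E. lra.
Qed.

Definition cexp (w : C) : C := (exp (fst w) * cos (snd w), exp (fst w) * sin (snd w)).

Lemma cexp_plus (z w : C) : cexp (z + w) = (cexp z * cexp w)%C.
Proof.
  apply injective_projections; simpl; rewrite exp_plus, ?cos_plus, ?sin_plus; ring.
Qed.

Lemma cexp_neq_0 (w : C) : cexp w <> 0.
Proof.
  intros E. apply (C1_nz). replace (RtoC 1) with (cexp w * cexp (- w))%C.
  - rewrite E. ring.
  - rewrite <- cexp_plus. replace (w + - w)%C with (RtoC 0) by ring.
    apply injective_projections; simpl; rewrite exp_0, ?cos_0, ?sin_0; ring.
Qed.

Lemma continuous_at_0 (a : R -> R) : continuous a 0 ->
  forall e, 0 < e -> exists d, 0 < d /\ forall x, Rabs x < d -> Rabs (a x - a 0) < e.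
Proof.
  intros H e e0. destruct (proj1 (filterlim_locally _ _) H (mkposreal e e0)) as [d Hd].
  exists d. split; [apply d|]. intros x Hx. apply Hd.
  change (Rabs (x - 0) < d). now rewrite Rminus_0_r.
Qed.

(** Complex differentiability of the exponential at 0, assembled from the real slope functions of
    exp, cos and sin at 0. *)
Lemma cexp_error e : 0 < e -> exists d, 0 < d /\
  forall w, Cmod w < d -> Cmod (cexp w - 1 - w) <= e * Cmod w.
Proof.
  intros e0.
  assert (De : is_derive exp 0 1) by (auto_derive; [easy|rewrite exp_0; ring]).
  assert (Dc : is_derive cos 0 0) by (auto_derive; [easy|rewrite sin_0; ring]).
  assert (Ds : is_derive sin 0 1) by (auto_derive; [easy|rewrite cos_0; ring]).
  destruct (slope_of_derive _ _ _ De) as [a [Ca [A0 Ea]]].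
  destruct (slope_of_derive _ _ _ Dc) as [b [Cb [B0 Eb]]].
  destruct (slope_of_derive _ _ _ Ds) as [s [Cs [S0 Es]]].
  (* With all the small quantities below [m], and [m <= 1] absorbing products of two of them, the
     real part costs [4 * m] and the imaginary part [3 * m], both times the modulus of w; their sum
     7m stays below e. *)
  assert (e1 : 0 < Rmin 1 (e / 12)) by (apply Rmin_pos; lra).
  set (m := Rmin 1 (e / 12)) in *.
  assert (m1 : m <= 1) by apply Rmin_l. assert (m2 : m <= e / 12) by apply Rmin_r.
  destruct (continuous_at_0 _ Ca _ e1) as [d1 [d10 H1]].
  destruct (continuous_at_0 _ Cb _ e1) as [d2 [d20 H2]].
  destruct (continuous_at_0 _ Cs _ e1) as [d3 [d30 H3]].
  destruct (continuous_at_0 exp (ex_derive_continuous _ _ (ex_intro _ _ De)) _ e1) as [d4 [d40 H4]].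
  destruct (continuous_at_0 cos (ex_derive_continuous _ _ (ex_intro _ _ Dc)) _ e1) as [d5 [d50 H5]].
  exists (Rmin d1 (Rmin d2 (Rmin d3 (Rmin d4 d5)))). split.
  { repeat apply Rmin_pos; easy. }
  intros w Hw.
  pose proof (Rabs_fst_le w) as F. pose proof (Rabs_snd_le w) as S.
  destruct w as [x y]. cbn [fst snd] in *.
  set (n := Cmod (x, y)) in *.
  assert (L1 := Rmin_l d1 (Rmin d2 (Rmin d3 (Rmin d4 d5)))).
  assert (L1' := Rmin_r d1 (Rmin d2 (Rmin d3 (Rmin d4 d5)))).
  assert (L2 := Rmin_l d2 (Rmin d3 (Rmin d4 d5))).
  assert (L2' := Rmin_r d2 (Rmin d3 (Rmin d4 d5))).
  assert (L3 := Rmin_l d3 (Rmin d4 d5)).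
  assert (L3' := Rmin_r d3 (Rmin d4 d5)).
  assert (L4 := Rmin_l d4 d5). assert (L4' := Rmin_r d4 d5).
  specialize (H1 x ltac:(lra)). specialize (H2 y ltac:(lra)).
  specialize (H3 y ltac:(lra)). specialize (H4 x ltac:(lra)). specialize (H5 y ltac:(lra)).
  specialize (Ea x). specialize (Eb y). specialize (Es y).
  rewrite A0 in H1. rewrite B0 in H2. rewrite S0 in H3.
  rewrite exp_0 in *. rewrite cos_0 in *. rewrite sin_0 in *.
  rewrite !Rminus_0_r in *.
  assert (P1 : Rabs (a x * cos y - 1) <= 3 * m).
  { replace (a x * cos y - 1) with ((a x - 1) * (cos y - 1) + (a x - 1) + (cos y - 1)) by ring.
    eapply Rle_trans; [apply Rabs_triang|].
    eapply Rle_trans; [apply Rplus_le_compat_r, Rabs_triang|].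
    rewrite Rabs_mult.
    pose proof (Rabs_pos (a x - 1)). pose proof (Rabs_pos (cos y - 1)). nra. }
  assert (P2 : Rabs (exp x * s y - 1) <= 3 * m).
  { replace (exp x * s y - 1) with ((exp x - 1) * (s y - 1) + (exp x - 1) + (s y - 1)) by ring.
    eapply Rle_trans; [apply Rabs_triang|].
    eapply Rle_trans; [apply Rplus_le_compat_r, Rabs_triang|].
    rewrite Rabs_mult.
    pose proof (Rabs_pos (exp x - 1)). pose proof (Rabs_pos (s y - 1)). nra. }
  eapply Rle_trans; [apply Cmod_le_sum|]. cbn [fst snd cexp Cminus Cplus Copp RtoC].
  replace (exp x * cos y + - (1) + - x) with (x * (a x * cos y - 1) + y * b y).
  2:{ transitivity ((exp x - 1) * cos y + (cos y - 1) - x); [rewrite Ea, Eb|]; ring. }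
  replace (exp x * sin y + - 0 + - y) with (y * (exp x * s y - 1)).
  2:{ rewrite Es. ring. }
  assert (Q1 : Rabs (x * (a x * cos y - 1) + y * b y) <= n * (4 * m)).
  { eapply Rle_trans; [apply Rabs_triang|]. rewrite !Rabs_mult.
    pose proof (Rabs_pos x). pose proof (Rabs_pos y).
    pose proof (Rabs_pos (a x * cos y - 1)). pose proof (Rabs_pos (b y)).
    assert (Rabs x * Rabs (a x * cos y - 1) <= n * (3 * m)) by (apply Rmult_le_compat; lra).
    assert (Rabs y * Rabs (b y) <= n * m) by (apply Rmult_le_compat; lra). lra. }
  assert (Q2 : Rabs (y * (exp x * s y - 1)) <= n * (3 * m)).
  { rewrite Rabs_mult. apply Rmult_le_compat; try apply Rabs_pos; easy. }
  assert (0 <= n) by apply Cmod_ge_0. nra.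
Qed.

Lemma polar_power_cexp a p : polar_power a p = cexp (a * Llog p).
Proof.
  unfold polar_power, cexp, cis, Llog, Rpower.
  apply injective_projections; simpl; rewrite !Rmult_0_l, ?Rminus_0_r, ?Rplus_0_r, ?Ropp_0, ?Rplus_0_r; ring.
Qed.

Lemma polar_power_neq_0 a p : polar_power a p <> 0.
Proof. rewrite polar_power_cexp. apply cexp_neq_0. Qed.

Lemma polar_point_power p : 0 < fst p -> polar_point p = polar_power 1 p.
Proof.
  intros H. unfold polar_point, polar_power. now rewrite Rpower_1, Rmult_1_l.
Qed.

Lemma polar_point_neq_0 p : 0 < fst p -> polar_point p <> 0.
Proof. intros. rewrite polar_point_power by easy. apply polar_power_neq_0. Qed.

Lemma cdiff_polar_power a p : 0 < fst p ->
  cdiff Llog (polar_power a) p (a * polar_power a p).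
Proof.
  intros Hp. apply cdiff_of_error. intros e e0.
  (* [K] dominates |(r e^{i theta})^a| |a|, the factor lost in scaling by [a] and multiplying by the
     power at [p]; the added ones keep it positive when [a = 0]. *)
  set (K := (1 + Cmod (polar_power a p)) * (1 + Rabs a)).
  assert (K0 : 0 < K).
  { unfold K. apply Rmult_lt_0_compat; [pose proof (Cmod_ge_0 (polar_power a p))|pose proof (Rabs_pos a)]; lra. }
  destruct (cexp_error (e / K)) as [d [d0 Hd]]; [now apply Rdiv_lt_0_compat|].
  assert (Cu : ccontinuous (fun q => a * (Llog q - Llog p))%C p).
  { apply ccontinuous_mult; [apply ccontinuous_const|].
    apply ccontinuous_minus; [now apply Llog_continuous|apply ccontinuous_const]. }
  destruct (proj1 (ccontinuous_eps _ _) Cu d d0) as [r [r0 Hr]].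
  apply locally_Cmod. exists r. split; [easy|]. intros q Hq.
  specialize (Hr q Hq).
  replace (a * (Llog q - Llog p) - a * (Llog p - Llog p))%C
    with (a * (Llog q - Llog p))%C in Hr by ring.
  specialize (Hd _ Hr). set (w := (a * (Llog q - Llog p))%C) in *.
  replace (polar_power a q) with (polar_power a p * cexp w)%C.
  2:{ rewrite !polar_power_cexp, <- cexp_plus. f_equal. unfold w. ring. }
  replace (polar_power a p * cexp w - polar_power a p - a * polar_power a p * (Llog q - Llog p))%C
    with (polar_power a p * (cexp w - 1 - w))%C by (unfold w; ring).
  assert (Ew : Cmod w = Rabs a * Cmod (Llog q - Llog p))
    by (unfold w; now rewrite Cmod_mult, Cmod_R).
  rewrite Ew in Hd. rewrite Cmod_mult.
  eapply Rle_trans; [apply Rmult_le_compat_l; [apply Cmod_ge_0|exact Hd]|].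
  set (n := Cmod (Llog q - Llog p)).
  assert (0 <= n) by apply Cmod_ge_0.
  set (z := Cmod (polar_power a p)) in *.
  assert (0 <= z) by apply Cmod_ge_0. assert (0 <= Rabs a) by apply Rabs_pos.
  replace (z * (e / K * (Rabs a * n))) with (e * n * ((z * Rabs a) / K)) by (field; lra).
  rewrite <- (Rmult_1_r (e * n)) at 2. apply Rmult_le_compat_l; [nra|].
  apply (Rmult_le_reg_r K); [easy|]. unfold Rdiv. rewrite Rmult_assoc, Rinv_l by lra.
  unfold K. nra.
Qed.

Lemma cdiff_polar_point p : 0 < fst p -> cdiff Llog polar_point p (polar_point p).
Proof.
  intros Hp. rewrite (polar_point_power p Hp).
  replace (polar_power 1 p) with (1%R * polar_power 1 p)%C by ring.
  apply (cdiff_ext_loc _ (polar_power 1)); [|now apply cdiff_polar_power].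
  generalize (locally_fst_pos p Hp). apply filter_imp. intros q Hq.
  symmetry. now apply polar_point_power.
Qed.

(** * Differentials and piecewise smooth paths *)

(** dPsi = P dr + Q dtheta at [q], tested along all curves differentiable at the parameter where
    they meet [q]. This is exactly what the fundamental theorem of calculus along a path
    consumes. *)
Definition is_differential (Psi : C -> C) (q P Q : C) : Prop :=
  forall (g1 g2 : R -> R) (t d1 d2 : R), (g1 t, g2 t) = q ->
    is_derive g1 t d1 -> is_derive g2 t d2 ->
    is_cderive (fun s => Psi (g1 s, g2 s)) t (P * RtoC d1 + Q * RtoC d2)%C.

Lemma is_derive_continuous (u : R -> R) t l : is_derive u t l -> continuous u t.
Proof. intros H. apply (ex_derive_continuous u). now exists l. Qed.

Lemma ccontinuous_path (F : C -> C) (g1 g2 : R -> R) t :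
  continuous g1 t -> continuous g2 t -> ccontinuous F (g1 t, g2 t) ->
  ccontinuous (fun s => F (g1 s, g2 s)) t.
Proof.
  intros H1 H2 HF.
  apply (continuous_comp (V := C_UniformSpace) (fun s => (g1 s, g2 s)) F); [|easy].
  now apply ccontinuous_pair.
Qed.

Lemma locally_pulled (V : C -> Prop) (g1 g2 : R -> R) t :
  continuous g1 t -> continuous g2 t -> locally (T := C_UniformSpace) (g1 t, g2 t) V ->
  locally t (fun s => V (g1 s, g2 s)).
Proof. intros H1 H2. exact (ccontinuous_pair g1 g2 t H1 H2 V). Qed.

Lemma is_differential_Llog (q : C) : 0 < fst q -> is_differential Llog q (/ fst q)%R Ci.
Proof.
  intros Hq g1 g2 t d1 d2 <- H1 H2. simpl in *. unfold Llog. simpl.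
  replace (RtoC (/ g1 t) * d1 + Ci * d2)%C with (d1 * / g1 t, d2)
    by (apply injective_projections; simpl; ring).
  apply is_cderive_pair; [|easy].
  apply (is_derive_comp ln g1); [|easy]. now apply is_derive_ln.
Qed.

Lemma is_cderive_slope_ex (f : R -> C) t l :
  is_cderive f t l ->
  exists s, ccontinuous s t /\ s t = l /\ forall x, (f x - f t)%C = ((x - t)%R * s x)%C.
Proof.
  intros H.
  assert (H1 : is_derive (fun x => fst (f x)) t (fst l)).
  { refine (filterdiff_ext_lin _ _ _ (filterdiff_comp' (V := C_R_NormedModule) (W := R_NormedModule) f fst t _ _ H (filterdiff_linear _ (is_linear_fst (U := R_NormedModule) (V := R_NormedModule)))) _).
    intros y; simpl; reflexivity. }
  assert (H2 : is_derive (fun x => snd (f x)) t (snd l)).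
  { refine (filterdiff_ext_lin _ _ _ (filterdiff_comp' (V := C_R_NormedModule) (W := R_NormedModule) f snd t _ _ H (filterdiff_linear _ (is_linear_snd (U := R_NormedModule) (V := R_NormedModule)))) _).
    intros y; simpl; reflexivity. }
  destruct (slope_of_derive _ _ _ H1) as [s1 [C1 [E1 K1]]].
  destruct (slope_of_derive _ _ _ H2) as [s2 [C2 [E2 K2]]].
  exists (fun x => (s1 x, s2 x)). split; [|split].
  - now apply ccontinuous_pair.
  - rewrite E1, E2. symmetry. apply C_surjective.
  - intros x. apply injective_projections; simpl.
    + rewrite Rmult_0_l, Rminus_0_r. apply K1.
    + rewrite Rmult_0_l, Rplus_0_r. apply K2.
Qed.

Lemma is_differential_cdiff (Phi : C -> C) (q l : C) :
  0 < fst q -> cdiff Llog Phi q l -> is_differential Phi q (l * (/ fst q)%R) (l * Ci).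
Proof.
  intros Hq [rho [H1 [H2 H3]]] g1 g2 t d1 d2 E D1 D2.
  pose proof (is_derive_continuous _ _ _ D1). pose proof (is_derive_continuous _ _ _ D2).
  destruct (is_cderive_slope_ex _ _ _ (is_differential_Llog q Hq g1 g2 t d1 d2 E D1 D2))
    as [s [Cs [Es Ks]]].
  subst q.
  replace (l * (/ fst (g1 t, g2 t))%R * d1 + l * Ci * d2)%C
    with ((fun x => rho (g1 x, g2 x) * s x) t)%C by (rewrite Es, H3; ring).
  apply (is_cderive_slope (fun s => Phi (g1 s, g2 s)) (fun x => rho (g1 x, g2 x) * s x)%C).
  - generalize (locally_pulled _ g1 g2 t ltac:(easy) ltac:(easy) H1).
    apply filter_imp. intros x Ex. rewrite Ex, Ks. ring.
  - apply ccontinuous_mult; [|easy]. now apply ccontinuous_path.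
Qed.

(* The error is measured in the plane and not through [Llog], which spares a
   Lipschitz bound for the inverse of [Llog]. *)
Lemma is_differential_error (Phi : C -> C) (q l : C) :
  0 < fst q ->
  (forall e, 0 < e -> locally (T := C_UniformSpace) q
     (fun z => Cmod (Phi z - Phi q - l * (Llog z - Llog q)) <= e * Cmod (z - q))) ->
  is_differential Phi q (l * (/ fst q)%R) (l * Ci).
Proof.
  intros Hq He g1 g2 t d1 d2 E D1 D2.
  pose proof (is_derive_continuous _ _ _ D1) as Cg1.
  pose proof (is_derive_continuous _ _ _ D2) as Cg2.
  destruct (is_cderive_slope_ex _ _ _ (is_differential_Llog q Hq g1 g2 t d1 d2 E D1 D2))
    as [s [Cs [Es Ks]]].
  destruct (is_cderive_slope_ex _ _ _ (is_cderive_pair _ _ _ _ _ D1 D2))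
    as [v [Cv [Ev Kv]]].
  subst q.
  set (err := fun z => (Phi z - Phi (g1 t, g2 t) - l * (Llog z - Llog (g1 t, g2 t)))%C) in *.
  (* Slope along the curve of the error term, completed by 0. Its continuity at [t] holds because
     the error is o(distance in the plane) and that distance is at most [M * Rabs (x - t)] near
     [t]. *)
  set (r := fun x : R => if Req_EM_T x t then RtoC 0 else (err (g1 x, g2 x) / (x - t)%R)%C).
  assert (r0 : r t = 0) by (unfold r; destruct (Req_EM_T t t); easy).
  replace (l * (/ fst (g1 t, g2 t))%R * d1 + l * Ci * d2)%C
    with ((fun x => r x + l * s x) t)%C by (rewrite Es, r0; ring).
  apply (is_cderive_slope (fun s => Phi (g1 s, g2 s)) (fun x => r x + l * s x)%C).
  - apply filter_forall. intros x. unfold r. destruct (Req_EM_T x t) as [->|N].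
    + unfold Rminus. rewrite Rplus_opp_r. ring.
    + transitivity (err (g1 x, g2 x) + l * ((x - t)%R * s x))%C.
      * rewrite <- Ks. unfold err. ring.
      * field. intros K. apply RtoC_inj in K. lra.
  - apply ccontinuous_plus; [|apply ccontinuous_mult; [apply ccontinuous_const|easy]].
    apply ccontinuous_eps_R. intros e e0. rewrite r0.
    set (M := Cmod (v t) + 1). assert (M0 : 0 < M).
    { unfold M. pose proof (Cmod_ge_0 (v t)). lra. }
    destruct (locally_pulled _ g1 g2 t Cg1 Cg2 (He (e / (2 * M)) ltac:(apply Rdiv_lt_0_compat; lra))) as [a Ha].
    destruct (proj1 (ccontinuous_eps_R v t) Cv 1 Rlt_0_1) as [b [b0 Hb]].
    exists (Rmin a b). split; [apply Rmin_pos; [apply a|easy]|].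
    intros x Hx. unfold r. destruct (Req_EM_T x t) as [->|N].
    { replace (0 - 0)%C with (RtoC 0) by ring. now rewrite Cmod_0. }
    specialize (Ha x (Rlt_le_trans _ _ _ Hx (Rmin_l _ _))).
    specialize (Hb x (Rlt_le_trans _ _ _ Hx (Rmin_r _ _))).
    change (Cmod (err (g1 x, g2 x)) <= e / (2 * M) * Cmod ((g1 x, g2 x) - (g1 t, g2 t))) in Ha.
    rewrite Kv, Cmod_mult, Cmod_R in Ha.
    assert (Nx : RtoC (x - t) <> 0) by (intros K; apply RtoC_inj in K; lra).
    replace (err (g1 x, g2 x) / (x - t)%R - 0)%C with (err (g1 x, g2 x) / (x - t)%R)%C by ring.
    rewrite Cmod_div, Cmod_R by easy.
    assert (A0 : 0 < Rabs (x - t)) by (apply Rabs_pos_lt; lra).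
    assert (Bv : Cmod (v x) <= M).
    { unfold M. pose proof (Cmod_triangle_sub (v x) (v t)). lra. }
    apply (Rle_lt_trans _ (e / 2)); [|lra].
    apply (Rmult_le_reg_r (Rabs (x - t))); [easy|].
    unfold Rdiv at 1. rewrite Rmult_assoc, Rinv_l, Rmult_1_r by lra.
    eapply Rle_trans; [exact Ha|].
    replace (e / 2 * Rabs (x - t)) with (e / (2 * M) * (Rabs (x - t) * M)) by (field; lra).
    apply Rmult_le_compat_l; [apply Rlt_le, Rdiv_lt_0_compat; lra|].
    apply Rmult_le_compat_l; lra.
Qed.

(** * Piecewise C^1 paths and line integrals along them *)

Definition is_C1 (u : R -> R) : Prop :=
  (forall s, ex_derive u s) /\ (forall s, continuous (Derive u) s).

Lemma C1_is_derive u t : is_C1 u -> is_derive u t (Derive u t).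
Proof. intros [H _]. apply Derive_correct, H. Qed.

Lemma C1_continuous u t : is_C1 u -> continuous u t.
Proof. intros H. eapply is_derive_continuous, C1_is_derive, H. Qed.

Definition pullback (P Q : C -> C) (g1 g2 : R -> R) (t : R) : C :=
  (P (g1 t, g2 t) * RtoC (Derive g1 t) + Q (g1 t, g2 t) * RtoC (Derive g2 t))%C.

Lemma pullback_continuous P Q g1 g2 t : is_C1 g1 -> is_C1 g2 ->
  ccontinuous P (g1 t, g2 t) -> ccontinuous Q (g1 t, g2 t) ->
  ccontinuous (pullback P Q g1 g2) t.
Proof.
  intros H1 H2 HP HQ. unfold pullback.
  pose proof (C1_continuous _ t H1). pose proof (C1_continuous _ t H2).
  apply ccontinuous_plus; apply ccontinuous_mult.
  - now apply ccontinuous_path.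
  - apply ccontinuous_RtoC, H1.
  - now apply ccontinuous_path.
  - apply ccontinuous_RtoC, H2.
Qed.

Lemma pullback_exact Psi P Q g1 g2 a b : a <= b -> is_C1 g1 -> is_C1 g2 ->
  (forall t, a <= t <= b ->
     is_differential Psi (g1 t, g2 t) (P (g1 t, g2 t)) (Q (g1 t, g2 t)) /\
     ccontinuous P (g1 t, g2 t) /\ ccontinuous Q (g1 t, g2 t)) ->
  is_CInt (pullback P Q g1 g2) a b (Psi (g1 b, g2 b) - Psi (g1 a, g2 a))%C.
Proof.
  intros ab H1 H2 H.
  apply (is_RInt_derive (V := C_R_CompleteNormedModule)
           (fun t => Psi (g1 t, g2 t)) (pullback P Q g1 g2)).
  - rewrite Rmin_left, Rmax_right by easy. intros t Ht.
    destruct (H t Ht) as [HD _]. now apply HD; [|apply C1_is_derive..].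
  - rewrite Rmin_left, Rmax_right by easy. intros t Ht.
    destruct (H t Ht) as [_ [HP HQ]]. now apply pullback_continuous.
Qed.

Lemma ex_CInt_continuous (f : R -> C) a b : a <= b ->
  (forall t, a <= t <= b -> ccontinuous f t) -> ex_CInt f a b.
Proof.
  intros ab H. apply (ex_RInt_continuous (V := C_R_CompleteNormedModule)).
  rewrite Rmin_left, Rmax_right by easy. exact H.
Qed.

Lemma ccontinuous_bounded (f : R -> C) a b : a <= b ->
  (forall t, a <= t <= b -> ccontinuous f t) ->
  exists M, forall t, a <= t <= b -> Cmod (f t) <= M.
Proof.
  intros ab H.
  destruct (continuity_ab_maj (fun t => Cmod (f t)) a b ab) as [x [Hx _]].
  - intros t Ht. apply continuity_pt_filterlim. apply filterlim_locally. intros e.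
    destruct (proj1 (ccontinuous_eps_R f t) (H t Ht) e (cond_pos e)) as [d [d0 Hd]].
    exists (mkposreal d d0). intros s Hs. specialize (Hd s Hs).
    change (Rabs (Cmod (f s) - Cmod (f t)) < e).
    pose proof (Cmod_triangle_sub (f s) (f t)).
    pose proof (Cmod_triangle_sub (f t) (f s)) as K. rewrite Cmod_sym in K.
    apply Rabs_def1; lra.
  - now exists (Cmod (f x)).
Qed.

(** Both coordinates share one subdivision here, whereas [piecewise_C1] gives each coordinate its
    own. The inductive form lets integrals be handled piece by piece, from left to right. *)
Inductive piecewise_path (gamma : R -> C) : R -> R -> Prop :=
| path_nil a : piecewise_path gamma a a
| path_cons a b c g1 g2 :
    a < b -> is_C1 g1 -> is_C1 g2 ->
    (forall s, a <= s <= b -> gamma s = (g1 s, g2 s)) ->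
    piecewise_path gamma b c -> piecewise_path gamma a c.

Lemma piecewise_path_le gamma a b : piecewise_path gamma a b -> a <= b.
Proof. induction 1; lra. Qed.

Inductive piecewise_coord (x : R -> R) : R -> R -> Prop :=
| coord_nil a : piecewise_coord x a a
| coord_cons a b c g :
    a < b -> is_C1 g -> (forall s, a <= s <= b -> x s = g s) ->
    piecewise_coord x b c -> piecewise_coord x a c.

Lemma piecewise_coord_le x a b : piecewise_coord x a b -> a <= b.
Proof. induction 1; lra. Qed.

Lemma piecewise_C1_coord x a b : piecewise_C1 x a b -> piecewise_coord x a b.
Proof.
  intros [n [t [<- [<- [Hlt Hg]]]]].
  assert (H : forall m, (m <= n)%nat -> piecewise_coord x (t (n - m)%nat) (t n)).
  { induction m; intros Hm.
    - rewrite Nat.sub_0_r. constructor.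
    - destruct (Hg (n - S m)%nat) as [g [G1 [G2 G3]]]; [lia|].
      pose proof (Hlt (n - S m)%nat ltac:(lia)) as L.
      replace (S (n - S m)) with (n - m)%nat in * by lia.
      apply (coord_cons x _ (t (n - m)%nat) _ g); try easy. apply IHm. lia. }
  specialize (H n (le_n _)). now rewrite Nat.sub_diag in H.
Qed.

Lemma piecewise_coord_split x a b d : piecewise_coord x a b -> a <= d <= b ->
  piecewise_coord x a d /\ piecewise_coord x d b.
Proof.
  induction 1 as [a|a b c g ab Cg Eg H IH]; intros Hd.
  - replace d with a by lra. split; constructor.
  - destruct (Rle_lt_dec b d) as [L|L].
    + destruct IH as [I1 I2]; [lra|]. split; [|easy].
      now apply (coord_cons x a b d g).
    + split.
      * destruct (Req_dec a d) as [->|N]; [constructor|].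
        apply (coord_cons x a d d g); [lra|easy| |constructor].
        intros s Hs. apply Eg. lra.
      * apply (coord_cons x d b c g); [lra|easy| |easy].
        intros s Hs. apply Eg. lra.
Qed.

Lemma piecewise_path_app gamma a b c :
  piecewise_path gamma a b -> piecewise_path gamma b c -> piecewise_path gamma a c.
Proof.
  induction 1 as [a|a b d g1 g2 ab C1 C2 E H IH]; intros K; [easy|].
  apply (path_cons gamma a b c g1 g2); auto.
Qed.

(** Common refinement of two subdivisions: the outer induction runs over the pieces of the first
    coordinate, the inner one over the pieces of the second cut down to that interval. *)
Lemma piecewise_path_of_coords (gamma : R -> C) a b :
  piecewise_coord (fun t => fst (gamma t)) a b ->
  piecewise_coord (fun t => snd (gamma t)) a b -> piecewise_path gamma a b.
Proof.
  induction 1 as [a|a b c g1 ab C1 E1 H IH]; intros K; [constructor|].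
  pose proof (piecewise_coord_le _ _ _ H).
  destruct (piecewise_coord_split _ _ _ b K) as [K1 K2]; [lra|].
  apply (piecewise_path_app _ a b c); [|now apply IH].
  clear - C1 E1 K1.
  induction K1 as [a|a d c g2 ad C2 E2 K IH]; [constructor|].
  pose proof (piecewise_coord_le _ _ _ K).
  apply (path_cons gamma a d c g1 g2); try easy.
  - intros s Hs. rewrite (C_surjective (gamma s)), <- E2, E1; [easy|lra|easy].
  - apply IH. intros s Hs. apply E1. lra.
Qed.

Definition line_integrand (gamma : R -> C) (P Q : C -> C) (t : R) : C :=
  (P (gamma t) * RtoC (Derive (fun s => fst (gamma s)) t) +
   Q (gamma t) * RtoC (Derive (fun s => snd (gamma s)) t))%C.

(** Only interior parameters are covered: at a breakpoint [gamma] may have no derivative, and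
    [Derive] then returns an arbitrary value. *)
Lemma line_integrand_piece gamma P Q g1 g2 a b t :
  (forall s, a <= s <= b -> gamma s = (g1 s, g2 s)) -> a < t < b ->
  line_integrand gamma P Q t = pullback P Q g1 g2 t.
Proof.
  intros E Ht. unfold line_integrand, pullback. rewrite (E t) by lra.
  assert (L : locally t (fun s => gamma s = (g1 s, g2 s))).
  { assert (d0 : 0 < Rmin (t - a) (b - t)) by (apply Rmin_pos; lra).
    exists (mkposreal _ d0). intros s Hs. apply E.
    assert (Hs' : Rabs (s - t) < Rmin (t - a) (b - t)) by exact Hs.
    pose proof (Rmin_l (t - a) (b - t)). pose proof (Rmin_r (t - a) (b - t)).
    apply Rabs_def2 in Hs'. lra. }
  assert (D1 : Derive (fun s => fst (gamma s)) t = Derive g1 t).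
  { apply Derive_ext_loc. revert L. apply filter_imp. now intros s ->. }
  assert (D2 : Derive (fun s => snd (gamma s)) t = Derive g2 t).
  { apply Derive_ext_loc. revert L. apply filter_imp. now intros s ->. }
  now rewrite D1, D2.
Qed.

Lemma line_integral_exact gamma Psi P Q a b : piecewise_path gamma a b ->
  (forall t, a <= t <= b ->
     is_differential Psi (gamma t) (P (gamma t)) (Q (gamma t)) /\
     ccontinuous P (gamma t) /\ ccontinuous Q (gamma t)) ->
  is_CInt (line_integrand gamma P Q) a b (Psi (gamma b) - Psi (gamma a))%C.
Proof.
  induction 1 as [a|a b c g1 g2 ab C1 C2 E K IH]; intros H.
  - replace (Psi (gamma a) - Psi (gamma a))%C with (RtoC 0) by ring.
    apply (is_RInt_point (V := C_R_NormedModule)).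
  - pose proof (piecewise_path_le _ _ _ K).
    replace (Psi (gamma c) - Psi (gamma a))%C
      with ((Psi (gamma b) - Psi (gamma a)) + (Psi (gamma c) - Psi (gamma b)))%C by ring.
    apply (is_RInt_Chasles (V := C_R_NormedModule) _ a b c).
    2:{ apply IH. intros t Ht. apply H. lra. }
    rewrite (E a), (E b) by lra.
    apply (is_RInt_ext (V := C_R_NormedModule) (pullback P Q g1 g2)).
    { rewrite Rmin_left, Rmax_right by lra. intros t Ht. symmetry.
      now apply line_integrand_piece with a b. }
    apply pullback_exact; try easy; [lra|].
    intros t Ht. rewrite <- (E t Ht). apply H. lra.
Qed.

(** The bound holds at every parameter, breakpoints included; it later makes the error in
    differentiating under the integral sign uniform. *)
Lemma line_integrand_regular gamma P Q a b : piecewise_path gamma a b ->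
  (forall t, a <= t <= b -> ccontinuous P (gamma t) /\ ccontinuous Q (gamma t)) ->
  ex_CInt (line_integrand gamma P Q) a b /\
  exists M, forall t, a <= t <= b -> Cmod (line_integrand gamma P Q t) <= M.
Proof.
  induction 1 as [a|a b c g1 g2 ab C1 C2 E K IH]; intros H.
  - split; [apply ex_RInt_point|].
    exists (Cmod (line_integrand gamma P Q a)). intros t Ht. replace t with a by lra. lra.
  - pose proof (piecewise_path_le _ _ _ K).
    destruct IH as [I1 [M2 I2]]. { intros t Ht. apply H. lra. }
    assert (Cp : forall t, a <= t <= b -> ccontinuous (pullback P Q g1 g2) t).
    { intros t Ht. destruct (H t) as [H1 H2]; [lra|]. rewrite (E t Ht) in H1, H2.
      now apply pullback_continuous. }
    split.
    + apply (ex_RInt_Chasles (V := C_R_NormedModule) _ a b c); [|easy].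
      apply (ex_RInt_ext (V := C_R_NormedModule) (pullback P Q g1 g2)).
      { rewrite Rmin_left, Rmax_right by lra. intros t Ht. symmetry.
        now apply line_integrand_piece with a b. }
      apply ex_CInt_continuous; [lra|easy].
    + destruct (ccontinuous_bounded _ a b (Rlt_le _ _ ab) Cp) as [M1 HM1].
      (* The value at the left breakpoint [a] of the piece is not controlled by [M1], so it enters
         the maximum by itself; the right end [b] is covered by [M2]. *)
      exists (Rmax (Cmod (line_integrand gamma P Q a)) (Rmax M1 M2)).
      intros t Ht.
      destruct (Rle_lt_dec b t) as [L|L].
      { eapply Rle_trans; [apply I2; lra|].
        eapply Rle_trans; [|apply Rmax_r]. apply Rmax_r. }
      destruct (Req_dec a t) as [->|N]; [apply Rmax_l|].
      rewrite (line_integrand_piece _ _ _ g1 g2 a b) by (easy || lra).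
      eapply Rle_trans; [apply HM1; lra|].
      eapply Rle_trans; [|apply Rmax_r]. apply Rmax_l.
Qed.

(** * Goursat's lemma *)

Lemma half_pow_small e : 0 < e -> exists n, (/ 2) ^ n < e.
Proof.
  intros e0. destruct (pow_lt_1_zero (/ 2)) with e as [N HN]; [rewrite Rabs_pos_eq; lra|easy|].
  exists N. specialize (HN N (le_n _)).
  rewrite Rabs_pos_eq in HN; [easy|]. apply pow_le. lra.
Qed.

(** The intervals of radius 2^{-n} around [u n] are nested, and the supremum of their left ends lies
    in all of them. *)
Lemma half_steps_limit (u : nat -> R) :
  (forall n, Rabs (u (S n) - u n) <= (/ 2) ^ S n) ->
  exists l, forall n, Rabs (u n - l) <= (/ 2) ^ n.
Proof.
  intros H.
  assert (P : forall n, 0 < (/ 2) ^ n) by (intros; apply pow_lt; lra).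
  assert (Hk : forall k n, u n - (/ 2) ^ n <= u (k + n)%nat - (/ 2) ^ (k + n) /\
                      u (k + n)%nat + (/ 2) ^ (k + n) <= u n + (/ 2) ^ n).
  { induction k; intros n; simpl; [lra|].
    destruct (IHk n) as [I1 I2]. specialize (H (k + n)%nat). simpl in H.
    apply Rabs_le_between in H. lra. }
  assert (Hnm : forall n m, u n - (/ 2) ^ n <= u m + (/ 2) ^ m).
  { intros n m. destruct (Hk m n) as [A1 _]. destruct (Hk n m) as [_ A2].
    rewrite Nat.add_comm in A2. specialize (P (m + n)%nat). lra. }
  destruct (completeness (fun x => exists n, x = u n - (/ 2) ^ n)) as [l [L1 L2]].
  - exists (u O + (/ 2) ^ 0). intros x [n ->]. apply Hnm.
  - exists (u O - (/ 2) ^ 0). now exists O.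
  - exists l. intros n.
    assert (u n - (/ 2) ^ n <= l) by (apply L1; now exists n).
    assert (l <= u n + (/ 2) ^ n) by (apply L2; intros x [m ->]; apply Hnm).
    apply Rabs_le_between. lra.
Qed.

(* The triangle with vertices (x, y), (x + h, y), (x, y + h) in barycentric coordinates;
   the middle one of the four half-size triangles has a negative h. *)
Definition sub_triangle (x y h : R) : Prop :=
  0 <= x /\ 0 <= y /\ x + y <= 1 /\ 0 <= x + h /\ 0 <= y + h /\ x + y + h <= 1.

(** The combinatorial half of Goursat's argument, for any quantity additive under bisection. Some
    quarter keeps at least a fourth of |T|, which is incompatible with a bound o(h^2) at the point
    where the triangles shrink. The middle triangle is a rotation by a half turn, so it enters with
    a plus sign. *)
Lemma triangle_bisection (T : R -> R -> R -> C) :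
  (forall x y h, sub_triangle x y h ->
     T x y h = (T x y (h / 2)%R + T (x + h / 2)%R y (h / 2)%R
                + T x (y + h / 2)%R (h / 2)%R + T (x + h / 2)%R (y + h / 2)%R (- (h / 2))%R)%C) ->
  (forall x0 y0, 0 <= x0 -> 0 <= y0 -> x0 + y0 <= 1 -> forall e, 0 < e ->
     exists d, 0 < d /\ forall x y h, sub_triangle x y h -> Rabs h < d ->
       Rabs (x - x0) <= Rabs h -> Rabs (y - y0) <= Rabs h -> Cmod (T x y h) <= e * h ^ 2) ->
  T 0 0 1 = 0.
Proof.
  intros Hsum Hloc.
  (* The subtriangle condition is kept as a premise inside, so that choice yields a total step
     function that can be iterated. *)
  assert (Hstep : forall s : R * R * R, exists s' : R * R * R,
    let '(x, y, h) := s in let '(x', y', h') := s' in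
    sub_triangle x y h -> sub_triangle x' y' h' /\ Rabs h' = Rabs h / 2 /\
      Rabs (x' - x) <= Rabs h / 2 /\ Rabs (y' - y) <= Rabs h / 2 /\
      Cmod (T x y h) <= 4 * Cmod (T x' y' h')).
  { intros [[x y] h].
    destruct (classic (sub_triangle x y h)) as [I|]; [|now exists (x, y, h)].
    pose proof (Hsum x y h I) as E. unfold sub_triangle in I.
    assert (A : Rabs (h / 2) = Rabs h / 2)
      by (unfold Rdiv; rewrite Rabs_mult, (Rabs_pos_eq (/ 2)); lra).
    pose proof (Rabs_pos h) as A0.
    assert (X : forall z, Rabs (z - z) <= Rabs h / 2)
      by (intros z; rewrite Rminus_diag, Rabs_R0; lra).
    assert (Y : forall z, Rabs (z + h / 2 - z) <= Rabs h / 2)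
      by (intros z; replace (z + h / 2 - z) with (h / 2) by ring; lra).
    set (t := Cmod (T x y h)).
    destruct (Rle_lt_dec t (4 * Cmod (T x y (h / 2)%R))) as [L1|L1].
    { exists (x, y, h / 2). intros _. repeat split; auto; lra. }
    destruct (Rle_lt_dec t (4 * Cmod (T (x + h / 2)%R y (h / 2)%R))) as [L2|L2].
    { exists (x + h / 2, y, h / 2). intros _. repeat split; auto; lra. }
    destruct (Rle_lt_dec t (4 * Cmod (T x (y + h / 2)%R (h / 2)%R))) as [L3|L3].
    { exists (x, y + h / 2, h / 2). intros _. repeat split; auto; lra. }
    exists (x + h / 2, y + h / 2, - (h / 2)). intros _. rewrite Rabs_Ropp.
    repeat split; auto; try lra.
    fold t. apply (f_equal Cmod) in E. fold t in E.
    pose proof (Cmod_triangle (T x y (h / 2)%R + T (x + h / 2)%R y (h / 2)%R + T x (y + h / 2)%R (h / 2)%R)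
                  (T (x + h / 2)%R (y + h / 2)%R (- (h / 2))%R)).
    pose proof (Cmod_triangle (T x y (h / 2)%R + T (x + h / 2)%R y (h / 2)%R) (T x (y + h / 2)%R (h / 2)%R)).
    pose proof (Cmod_triangle (T x y (h / 2)%R) (T (x + h / 2)%R y (h / 2)%R)). lra. }
  set (step := fun s => proj1_sig (constructive_indefinite_description _ (Hstep s))).
  assert (Hs : forall s, let '(x, y, h) := s in let '(x', y', h') := step s in
    sub_triangle x y h -> sub_triangle x' y' h' /\ Rabs h' = Rabs h / 2 /\
      Rabs (x' - x) <= Rabs h / 2 /\ Rabs (y' - y) <= Rabs h / 2 /\
      Cmod (T x y h) <= 4 * Cmod (T x' y' h')).
  { intros s. unfold step. apply (proj2_sig (constructive_indefinite_description _ (Hstep s))). }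
  clearbody step.
  set (u := fun n => Nat.iter n step (0, 0, 1)).
  set (X := fun n => fst (fst (u n))). set (Y := fun n => snd (fst (u n))).
  set (H := fun n => snd (u n)).
  assert (Hu : forall n, sub_triangle (X n) (Y n) (H n) /\ Rabs (H n) = (/ 2) ^ n /\
                    Cmod (T 0 0 1) <= 4 ^ n * Cmod (T (X n) (Y n) (H n))).
  { induction n as [|n [I1 [I2 I3]]].
    - unfold X, Y, H; simpl. unfold sub_triangle. rewrite Rabs_R1. repeat split; lra.
    - specialize (Hs (u n)). change (step (u n)) with (u (S n)) in Hs.
      unfold X, Y, H in *. destruct (u n) as [[x y] h]. destruct (u (S n)) as [[x' y'] h'].
      simpl in *. destruct (Hs I1) as [J1 [J2 [_ [_ J3]]]]. repeat split; try apply J1; [lra|].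
      assert (0 < 4 ^ n) by (apply pow_lt; lra). nra. }
  assert (Hxy : forall n, Rabs (X (S n) - X n) <= (/ 2) ^ S n /\ Rabs (Y (S n) - Y n) <= (/ 2) ^ S n).
  { intros n. destruct (Hu n) as [I1 [I2 _]].
    specialize (Hs (u n)). change (step (u n)) with (u (S n)) in Hs.
    unfold X, Y, H in *. destruct (u n) as [[x y] h]. destruct (u (S n)) as [[x' y'] h'].
    simpl in *. destruct (Hs I1) as [_ [_ [J1 [J2 _]]]]. lra. }
  destruct (half_steps_limit X (fun n => proj1 (Hxy n))) as [x0 Hx0].
  destruct (half_steps_limit Y (fun n => proj2 (Hxy n))) as [y0 Hy0].
  (* The closed triangle contains the limit point: each of its inequalities holds at the n-th
     vertex, hence at the limit up to an error of 2 * 2^{-n}. *)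
  assert (Lim : forall z, (forall n, - 2 * (/ 2) ^ n <= z) -> 0 <= z).
  { intros z Hz. destruct (Rle_lt_dec 0 z) as [|L]; [easy|].
    destruct (half_pow_small (- z / 2)) as [n Hn]; [lra|]. specialize (Hz n). lra. }
  apply NNPP. intros N. assert (T0 : 0 < Cmod (T 0 0 1)).
  { apply Cmod_gt_0. exact N. }
  destruct (Hloc x0 y0) with (e := Cmod (T 0 0 1) / 2) as [d [d0 Hd]].
  - apply Lim. intros n. destruct (Hu n) as [[I1 _] _]. specialize (Hx0 n).
    apply Rabs_le_between in Hx0. pose proof (pow_lt (/ 2) n ltac:(lra)). lra.
  - apply Lim. intros n. destruct (Hu n) as [[_ [I1 _]] _]. specialize (Hy0 n).
    apply Rabs_le_between in Hy0. pose proof (pow_lt (/ 2) n ltac:(lra)). lra.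
  - enough (0 <= 1 - (x0 + y0)) by lra. apply Lim. intros n.
    destruct (Hu n) as [[_ [_ [I1 _]]] _]. specialize (Hx0 n). specialize (Hy0 n).
    apply Rabs_le_between in Hx0. apply Rabs_le_between in Hy0. lra.
  - lra.
  - destruct (half_pow_small d d0) as [n Hn]. destruct (Hu n) as [I1 [I2 I3]].
    specialize (Hd _ _ _ I1). rewrite I2 in Hd. specialize (Hd Hn (Hx0 n) (Hy0 n)).
    (* The growth 4^n of the lower bound exactly compensates h^2, so half of [Cmod (T 0 0 1)] as [e]
       already gives a contradiction. *)
    assert (E : 4 ^ n * H n ^ 2 = 1).
    { rewrite <- (pow2_abs (H n)), I2, <- pow_mult, Nat.mul_comm, pow_mult, <- Rpow_mult_distr.
      replace (4 * (/ 2) ^ 2) with 1 by field. apply pow1. }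
    assert (0 < 4 ^ n) by (apply pow_lt; lra). nra.
Qed.

(** * Integrals of forms P dr + Q dtheta along straight segments *)

Definition line (p q : C) (s : R) : C :=
  ((1 - s) * fst p + s * fst q, (1 - s) * snd p + s * snd q).

Definition seg_integrand (P Q : C -> C) (p q : C) (s : R) : C :=
  (P (line p q s) * RtoC (fst q - fst p) + Q (line p q s) * RtoC (snd q - snd p))%C.

Definition seg (P Q : C -> C) (p q : C) : C := CInt (seg_integrand P Q p q) 0 1.

Definition ccontinuous_on (D : C -> Prop) (P : C -> C) : Prop := forall z, D z -> ccontinuous P z.

Lemma line_0 p q : line p q 0 = p.
Proof. apply injective_projections; simpl; ring. Qed.

Lemma line_1 p q : line p q 1 = q.
Proof. apply injective_projections; simpl; ring. Qed.

Lemma line_continuous p q s : ccontinuous (line p q) s.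
Proof.
  apply ccontinuous_pair.
  - apply (ex_derive_continuous (fun s => (1 - s) * fst p + s * fst q)). auto_derive; easy.
  - apply (ex_derive_continuous (fun s => (1 - s) * snd p + s * snd q)). auto_derive; easy.
Qed.

Lemma Cmod_line_le z p q s d : 0 <= s <= 1 ->
  Cmod (p - z) <= d -> Cmod (q - z) <= d -> Cmod (line p q s - z) <= d.
Proof.
  intros Hs Hp Hq.
  replace (line p q s - z)%C with ((1 - s)%R * (p - z) + s * (q - z))%C
    by (apply injective_projections; simpl; ring).
  eapply Rle_trans; [apply Cmod_triangle|].
  rewrite !Cmod_mult, !Cmod_R, !Rabs_pos_eq by lra.
  pose proof (Cmod_ge_0 (p - z)). pose proof (Cmod_ge_0 (q - z)). nra.
Qed.

Lemma Cmod_form_le (P Q v : C) M : Cmod P <= M -> Cmod Q <= M ->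
  Cmod (P * RtoC (fst v) + Q * RtoC (snd v)) <= 2 * M * Cmod v.
Proof.
  intros HP HQ. eapply Rle_trans; [apply Cmod_triangle|]. rewrite !Cmod_mult, !Cmod_R.
  pose proof (Rabs_fst_le v). pose proof (Rabs_snd_le v).
  pose proof (Cmod_ge_0 P). pose proof (Cmod_ge_0 Q).
  pose proof (Rabs_pos (fst v)). pose proof (Rabs_pos (snd v)). nra.
Qed.

Section Segments.
Variables (D : C -> Prop) (P Q : C -> C).
Hypotheses (D_convex : convex D) (P_cont : ccontinuous_on D P) (Q_cont : ccontinuous_on D Q).

Lemma line_in p q s : D p -> D q -> 0 <= s <= 1 -> D (line p q s).
Proof. intros Hp Hq Hs. now apply D_convex. Qed.

Lemma seg_integrand_continuous p q s : D p -> D q -> 0 <= s <= 1 ->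
  ccontinuous (seg_integrand P Q p q) s.
Proof.
  intros Hp Hq Hs. unfold seg_integrand.
  apply ccontinuous_plus; (apply ccontinuous_mult; [|apply ccontinuous_const]).
  - apply (continuous_comp (V := C_UniformSpace) (line p q) P); [apply line_continuous|].
    now apply P_cont, line_in.
  - apply (continuous_comp (V := C_UniformSpace) (line p q) Q); [apply line_continuous|].
    now apply Q_cont, line_in.
Qed.

Lemma is_CInt_seg p q : D p -> D q -> is_CInt (seg_integrand P Q p q) 0 1 (seg P Q p q).
Proof.
  intros Hp Hq. apply (RInt_correct (V := C_R_CompleteNormedModule)).
  apply ex_CInt_continuous; [lra|]. intros. now apply seg_integrand_continuous.
Qed.

(** Affine change of parameter. Since [u <= v] is not demanded, it gives the reversal of a segment
    as well as its subdivision. *)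
Lemma seg_sub p q u v : D p -> D q -> 0 <= u <= 1 -> 0 <= v <= 1 ->
  is_CInt (seg_integrand P Q p q) u v (seg P Q (line p q u) (line p q v)).
Proof.
  intros Hp Hq Hu Hv.
  assert (E : ex_CInt (seg_integrand P Q p q) u v).
  { apply (ex_RInt_continuous (V := C_R_CompleteNormedModule)). intros z Hz.
    apply seg_integrand_continuous; try easy. revert Hz.
    unfold Rmin, Rmax. destruct (Rle_dec u v); lra. }
  destruct E as [l Hl]. replace (seg P Q (line p q u) (line p q v)) with l; [easy|].
  symmetry. apply (is_RInt_unique (V := C_R_CompleteNormedModule)).
  apply (is_RInt_ext (V := C_R_NormedModule)
    (fun s => scal (v - u) (seg_integrand P Q p q ((v - u) * s + u) : C_R_NormedModule))).
  - intros s _.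
    assert (El : line (line p q u) (line p q v) s = line p q ((v - u) * s + u))
      by (apply injective_projections; simpl; ring).
    unfold seg_integrand. rewrite El.
    transitivity (RtoC (v - u) *
      (P (line p q ((v - u) * s + u)) * RtoC (fst q - fst p) +
       Q (line p q ((v - u) * s + u)) * RtoC (snd q - snd p)))%C.
    + apply injective_projections; simpl; unfold scal; simpl; unfold mult; simpl; ring.
    + replace (RtoC (fst (line p q v) - fst (line p q u))) with (RtoC (v - u) * RtoC (fst q - fst p))%C
        by (apply injective_projections; simpl; ring).
      replace (RtoC (snd (line p q v) - snd (line p q u))) with (RtoC (v - u) * RtoC (snd q - snd p))%C
        by (apply injective_projections; simpl; ring).
      match goal with |- ?x = ?y => change (@eq C x y) end. ring.
  - apply (is_RInt_comp_lin (V := C_R_NormedModule)).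
    now replace ((v - u) * 0 + u) with u by ring; replace ((v - u) * 1 + u) with v by ring.
Qed.

Lemma seg_swap p q : D p -> D q -> seg P Q q p = (- seg P Q p q)%C.
Proof.
  intros Hp Hq. 
  assert (H : is_CInt (seg_integrand P Q p q) 1 0 (seg P Q q p)).
  { rewrite <- (line_1 p q) at 2. rewrite <- (line_0 p q) at 3.
    apply seg_sub; try easy; lra. }
  apply (is_RInt_unique (V := C_R_CompleteNormedModule)) in H. rewrite <- H.
  apply (is_RInt_unique (V := C_R_CompleteNormedModule)).
  apply (is_RInt_swap (V := C_R_NormedModule)). now apply is_CInt_seg.
Qed.

Lemma seg_split p q s : D p -> D q -> 0 <= s <= 1 ->
  seg P Q p q = (seg P Q p (line p q s) + seg P Q (line p q s) q)%C.
Proof.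
  intros Hp Hq Hs. apply (is_RInt_unique (V := C_R_CompleteNormedModule)).
  apply (is_RInt_Chasles (V := C_R_NormedModule) _ 0 s 1).
  - rewrite <- (line_0 p q) at 2. apply seg_sub; try easy; lra.
  - rewrite <- (line_1 p q) at 3. apply seg_sub; try easy; lra.
Qed.

(** Comparison with a form that is exact along the segment; its integral is the increment of [Psi].
    The factor 2 comes from bounding |dr| and |dtheta| each by the displacement. *)
Lemma seg_error Psi P' Q' p q M : D p -> D q ->
  (forall s, 0 <= s <= 1 -> let z := line p q s in
     is_differential Psi z (P' z) (Q' z) /\ ccontinuous P' z /\ ccontinuous Q' z /\
     Cmod (P z - P' z) <= M /\ Cmod (Q z - Q' z) <= M) ->
  Cmod (seg P Q p q - (Psi q - Psi p)) <= 2 * M * Cmod (q - p).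
Proof.
  intros Hp Hq H.
  set (g1 := fun s => (1 - s) * fst p + s * fst q).
  set (g2 := fun s => (1 - s) * snd p + s * snd q).
  assert (D1 : forall s, is_derive g1 s (fst q - fst p))
    by (intros; unfold g1; auto_derive; [easy|ring]).
  assert (D2 : forall s, is_derive g2 s (snd q - snd p))
    by (intros; unfold g2; auto_derive; [easy|ring]).
  assert (C1g : is_C1 g1).
  { split; intros s; [eexists; apply D1|].
    apply (continuous_ext (fun _ => fst q - fst p)); [|apply continuous_const].
    intros t. symmetry. apply is_derive_unique, D1. }
  assert (C2g : is_C1 g2).
  { split; intros s; [eexists; apply D2|].
    apply (continuous_ext (fun _ => snd q - snd p)); [|apply continuous_const].
    intros t. symmetry. apply is_derive_unique, D2. }
  assert (I : is_CInt (pullback P' Q' g1 g2) 0 1 (Psi q - Psi p)%C).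
  { replace (Psi q - Psi p)%C with (Psi (g1 1, g2 1) - Psi (g1 0, g2 0))%C.
    2:{ change (g1 1, g2 1) with (line p q 1). change (g1 0, g2 0) with (line p q 0).
        now rewrite line_0, line_1. }
    apply pullback_exact; [lra|easy|easy|].
    intros t Ht. destruct (H t Ht) as [H1 [H2 [H3 _]]]. easy. }
  pose proof (is_RInt_minus (V := C_R_NormedModule) _ _ _ _ _ _ (is_CInt_seg p q Hp Hq) I) as J.
  apply (norm_RInt_le_const (V := C_R_NormedModule)) with (M := 2 * M * Cmod (q - p)) in J.
  - rewrite Cnorm_R in J. 
    replace ((1 - 0) * (2 * M * Cmod (q - p))) with (2 * M * Cmod (q - p)) in J by ring.
    exact J.
  - lra.
  - intros s Hs. rewrite Cnorm_R.
    destruct (H s Hs) as [_ [_ [_ [H1 H2]]]].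
    pose proof (Cmod_form_le _ _ (q - p)%C M H1 H2) as K.
    eapply Rle_trans; [|exact K]. right. f_equal.
    unfold pullback.
    assert (E1 : Derive g1 s = fst q - fst p) by apply is_derive_unique, D1.
    assert (E2 : Derive g2 s = snd q - snd p) by apply is_derive_unique, D2.
    rewrite E1, E2. unfold seg_integrand.
    change (g1 s, g2 s) with (line p q s).
    change (minus (G := C_R_NormedModule)) with Cminus. 
    apply injective_projections; simpl; ring.
Qed.

Lemma seg_bound p q M : D p -> D q ->
  (forall s, 0 <= s <= 1 -> Cmod (P (line p q s)) <= M /\ Cmod (Q (line p q s)) <= M) ->
  Cmod (seg P Q p q) <= 2 * M * Cmod (q - p).
Proof.
  intros Hp Hq H.
  replace (seg P Q p q) with (seg P Q p q - (0 - 0))%C by ring.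
  apply (seg_error (fun _ => RtoC 0) (fun _ => RtoC 0) (fun _ => RtoC 0)); [easy..|].
  intros s Hs z. split; [|split; [|split; [|split]]].
  - intros g1 g2 t d1 d2 _ _ _. replace (0 * d1 + 0 * d2)%C with (RtoC 0) by ring.
    apply (is_derive_const (V := C_R_NormedModule)).
  - apply ccontinuous_const.
  - apply ccontinuous_const.
  - replace (P z - 0)%C with (P z) by ring. now apply H.
  - replace (Q z - 0)%C with (Q z) by ring. now apply H.
Qed.

Lemma seg_point p : D p -> seg P Q p p = 0.
Proof.
  intros Hp. apply Cmod_eq_0. apply Rle_antisym; [|apply Cmod_ge_0].
  pose proof (seg_bound p p (Rmax (Cmod (P p)) (Cmod (Q p))) Hp Hp) as B.
  replace (p - p)%C with (RtoC 0) in B by ring. rewrite Cmod_0, Rmult_0_r in B.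
  apply B. intros s _. replace (line p p s) with p
    by (apply injective_projections; simpl; ring).
  split; [apply Rmax_l|apply Rmax_r].
Qed.

End Segments.

(* phi dLlog = log_dr phi dr + log_dtheta phi dtheta *)
Definition log_dr (phi : C -> C) (z : C) : C := (phi z * (/ fst z)%R)%C.
Definition log_dtheta (phi : C -> C) (z : C) : C := (phi z * Ci)%C.

Lemma log_dr_continuous phi z : 0 < fst z -> ccontinuous phi z -> ccontinuous (log_dr phi) z.
Proof.
  intros Hz H. apply ccontinuous_mult; [easy|]. apply ccontinuous_RtoC.
  apply (continuous_comp (U := C_UniformSpace) fst Rinv).
  - apply (continuous_fst (U := R_UniformSpace) (V := R_UniformSpace)).
  - apply continuous_Rinv. now apply Rgt_not_eq.
Qed.

Lemma log_dtheta_continuous phi z : ccontinuous phi z -> ccontinuous (log_dtheta phi) z.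
Proof. intros H. apply ccontinuous_mult; [easy|apply ccontinuous_const]. Qed.

Lemma Llog_lipschitz (z0 : C) : 0 < fst z0 -> exists K d, 0 < K /\ 0 < d /\
  forall z, Cmod (z - z0) < d ->
    / fst z <= K /\ 0 < fst z /\ 1 <= K /\ Cmod (Llog z - Llog z0) <= K * Cmod (z - z0).
Proof.
  intros H0.
  assert (Dl : is_derive ln (fst z0) (/ fst z0)) by now apply is_derive_ln.
  destruct (slope_of_derive _ _ _ Dl) as [s [Cs [Es Ks]]].
  destruct (proj1 (filterlim_locally _ _) Cs (mkposreal 1 Rlt_0_1)) as [d Hd].
  assert (I0 : 0 < / fst z0) by now apply Rinv_0_lt_compat.
  (* Within half the distance to the axis r = 0 one has 1/r <= 2/r0. The slope of ln is at most 1/r0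
     + 1 near r0, and the angle contributes 1 more. [K >= 1] lets one constant bound both
     coefficients 1/r and i of dLlog. *)
  exists (2 * / fst z0 + 2), (Rmin d (fst z0 / 2)). split; [lra|]. split.
  { apply Rmin_pos; [apply d|lra]. }
  intros z Hz. pose proof (Rabs_fst_le (z - z0)) as A1. pose proof (Rabs_snd_le (z - z0)) as A2.
  pose proof (Rmin_l d (fst z0 / 2)). pose proof (Rmin_r d (fst z0 / 2)).
  simpl in A1, A2.
  assert (B1 : Rabs (fst z + - fst z0) < fst z0 / 2) by lra. apply Rabs_def2 in B1.
  assert (Z : fst z0 / 2 < fst z) by lra.
  assert (I : / fst z <= 2 * / fst z0).
  { replace (2 * / fst z0) with (/ (fst z0 / 2)) by (field; lra).
    apply Rinv_le_contravar; lra. }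
  repeat split; [lra|lra|lra|].
  eapply Rle_trans; [apply Cmod_le_sum|]. simpl.
  change (ln (fst z) + - ln (fst z0)) with (ln (fst z) - ln (fst z0)). rewrite Ks, Rabs_mult.
  assert (S : Rabs (s (fst z)) <= / fst z0 + 1).
  { assert (S : Rabs (s (fst z) - s (fst z0)) < 1).
    { apply Hd. change (Rabs (fst z + - fst z0) < d). lra. }
    rewrite Es in S. apply Rabs_def2 in S. apply Rabs_le_between. lra. }
  change (fst z - fst z0) with (fst z + - fst z0).
  pose proof (Rabs_pos (fst z + - fst z0)). pose proof (Rabs_pos (s (fst z))).
  pose proof (Cmod_ge_0 (z - z0)).
  assert (Rabs (fst z + - fst z0) * Rabs (s (fst z)) <= Cmod (z - z0) * (/ fst z0 + 1))
    by (apply Rmult_le_compat; lra).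
  nra.
Qed.

Lemma Cmod_log_form_le phi psi z K M : 0 < fst z -> / fst z <= K -> 1 <= K ->
  Cmod (phi z - psi z) <= M ->
  Cmod (log_dr phi z - log_dr psi z) <= M * K /\
  Cmod (log_dtheta phi z - log_dtheta psi z) <= M * K.
Proof.
  intros Hz H1 H2 H. unfold log_dr, log_dtheta.
  replace (phi z * (/ fst z)%R - psi z * (/ fst z)%R)%C
    with ((phi z - psi z) * (/ fst z)%R)%C by ring.
  replace (phi z * Ci - psi z * Ci)%C with ((phi z - psi z) * Ci)%C by ring.
  rewrite !Cmod_mult, Cmod_R, Cmod_Ci.
  pose proof (Cmod_ge_0 (phi z - psi z)).
  assert (0 < / fst z) by now apply Rinv_0_lt_compat.
  rewrite Rabs_pos_eq by lra. split; apply Rmult_le_compat; lra.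
Qed.

Section Convex.
Variables (D : C -> Prop) (phi : C -> C).
Hypotheses (D_convex : convex D) (D_pos : forall z, D z -> 0 < fst z).
Hypothesis phi_cont : ccontinuous_on D phi.

Notation S := (seg (log_dr phi) (log_dtheta phi)).

Let P_cont : ccontinuous_on D (log_dr phi).
Proof. intros z Hz. apply log_dr_continuous; auto. Qed.

Let Q_cont : ccontinuous_on D (log_dtheta phi).
Proof. intros z Hz. apply log_dtheta_continuous; auto. Qed.

Lemma seg_log_error (z0 : C) K (d : R) Psi psi p q M :
  (forall z, Cmod (z - z0) < d -> / fst z <= K /\ 0 < fst z /\ 1 <= K /\
     Cmod (Llog z - Llog z0) <= K * Cmod (z - z0)) ->
  forall r, r < d -> D p -> D q -> Cmod (p - z0) <= r -> Cmod (q - z0) <= r ->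
  (forall z, Cmod (z - z0) <= r -> 0 < fst z -> cdiff Llog Psi z (psi z) /\ ccontinuous psi z) ->
  (forall z, D z -> Cmod (z - z0) <= r -> Cmod (phi z - psi z) <= M) ->
  Cmod (S p q - (Psi q - Psi p)) <= 2 * (M * K) * Cmod (q - p).
Proof.
  intros HK r Hr Hp Hq Np Nq HPsi HM.
  apply (seg_error D _ _ D_convex P_cont Q_cont Psi (log_dr psi) (log_dtheta psi)); try easy.
  intros s Hs z.
  assert (Nz : Cmod (z - z0) <= r) by now apply Cmod_line_le.
  assert (Dz : D z) by now apply line_in.
  destruct (HK z) as [K1 [K2 [K3 K4]]]; [lra|].
  destruct (HPsi z Nz K2) as [H1 H2].
  split; [now apply is_differential_cdiff|].
  split; [now apply log_dr_continuous|].
  split; [now apply log_dtheta_continuous|].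
  apply Cmod_log_form_le; auto.
Qed.

(** Freezing phi at [z0] leaves the exact form phi(z0) dLlog; continuity of phi bounds the rest.
    This will identify the differential of the primitive. *)
Lemma seg_log_first_order (z0 : C) : D z0 -> forall e, 0 < e ->
  locally (T := C_UniformSpace) z0 (fun q => D q ->
    Cmod (S z0 q - phi z0 * (Llog q - Llog z0)) <= e * Cmod (q - z0)).
Proof.
  intros H0 e e0.
  destruct (Llog_lipschitz z0 (D_pos _ H0)) as [K [d [K0 [d0 HK]]]].
  destruct (proj1 (ccontinuous_eps phi z0) (phi_cont _ H0) (e / (2 * K))) as [d1 [d10 H1]].
  { apply Rdiv_lt_0_compat; lra. }
  apply locally_Cmod. exists (Rmin d d1). split; [now apply Rmin_pos|].
  intros q Nq Hq. pose proof (Rmin_l d d1). pose proof (Rmin_r d d1).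
  replace (phi z0 * (Llog q - Llog z0))%C
    with (phi z0 * Llog q - phi z0 * Llog z0)%C by ring.
  replace e with (2 * (e / (2 * K) * K)) by (field; lra).
  apply (seg_log_error z0 K d (fun z => phi z0 * Llog z)%C (fun _ => phi z0)) with (Cmod (q - z0)); try easy.
  - lra.
  - replace (z0 - z0)%C with (RtoC 0) by ring. rewrite Cmod_0. apply Cmod_ge_0.
  - intros z _ Hz. split; [|apply ccontinuous_const].
    cut (cdiff Llog (fun z => phi z0 * Llog z)%C z (phi z0 * 1)); [now rewrite Cmult_1_r|].
    apply cdiff_scal; [now apply Llog_continuous|apply cdiff_self].
  - intros z _ Nz. apply Rlt_le, H1. lra.
Qed.

(** Near [z0], phi is affine in [Llog] up to o(distance), and an affine function of [Llog] has a
    quadratic primitive. The increments of [Psi] cancel around a closed triangle, leaving only the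
    o(r^2) errors. *)
Lemma seg_log_second_order (z0 l : C) : D z0 -> cdiff Llog phi z0 l -> forall e, 0 < e ->
  exists d Psi, 0 < d /\ forall r p q, r < d -> D p -> D q ->
    Cmod (p - z0) <= r -> Cmod (q - z0) <= r ->
    Cmod (S p q - (Psi q - Psi p)) <= e * r ^ 2.
Proof.
  intros H0 [rho [R1 [R2 R3]]] e e0.
  destruct (Llog_lipschitz z0 (D_pos _ H0)) as [K [d [K0 [d0 HK]]]].
  (* The final bound is 2 * (e / (4 K^2)) * (K r) * K * (2 r) = e r^2: the factor 2 of the form, the
     slope error, the growth of [Llog], the coefficients of dLlog, and the length of the side. *)
  destruct (proj1 (ccontinuous_eps rho z0) R2 (e / (4 * K * K))) as [d1 [d10 H1]].
  { apply Rdiv_lt_0_compat; nra. }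
  destruct (proj1 (locally_Cmod _ _) R1) as [d2 [d20 H2]].
  set (psi := fun z => (phi z0 + l * (Llog z - Llog z0))%C).
  exists (Rmin d (Rmin d1 d2)),
    (fun z => phi z0 * Llog z + / 2 * l * ((Llog z - Llog z0) * (Llog z - Llog z0)))%C.
  split; [repeat apply Rmin_pos; easy|].
  intros r p q Hr Hp Hq Np Nq.
  pose proof (Rmin_l d (Rmin d1 d2)). pose proof (Rmin_r d (Rmin d1 d2)).
  pose proof (Rmin_l d1 d2). pose proof (Rmin_r d1 d2).
  set (Psi := (fun z => phi z0 * Llog z + / 2 * l * ((Llog z - Llog z0) * (Llog z - Llog z0)))%C).
  assert (E : Cmod (S p q - (Psi q - Psi p))
              <= 2 * (e / (4 * K * K) * (K * r) * K) * Cmod (q - p)).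
  { apply (seg_log_error z0 K d Psi psi) with r; try easy; [lra| |].
    - intros z _ Hz. pose proof (Llog_continuous z Hz) as CL.
      split.
      + unfold Psi, psi.
        assert (DL : cdiff Llog (fun z => Llog z - Llog z0)%C z 1).
        { replace (RtoC 1) with (1 + 0)%C by ring.
          apply (cdiff_plus Llog Llog (fun _ => - Llog z0)%C); [apply cdiff_self|apply cdiff_const]. }
        replace (phi z0 + l * (Llog z - Llog z0))%C
          with (phi z0 * 1 + / 2 * l * (1 * (Llog z - Llog z0) + (Llog z - Llog z0) * 1))%C
          by field.
        apply cdiff_plus; (apply cdiff_scal; [easy|]); [apply cdiff_self|].
        now apply (cdiff_mult Llog (fun z => Llog z - Llog z0)%C (fun z => Llog z - Llog z0)%C).
      + apply ccontinuous_plus; [apply ccontinuous_const|].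
        apply ccontinuous_mult; [apply ccontinuous_const|].
        apply ccontinuous_minus; [easy|apply ccontinuous_const].
    - intros z _ Nz. unfold psi.
      replace (phi z - (phi z0 + l * (Llog z - Llog z0)))%C
        with ((rho z - rho z0) * (Llog z - Llog z0))%C.
      2:{ rewrite R3. specialize (H2 z ltac:(lra)).
          replace (phi z) with (phi z - phi z0 + phi z0)%C by ring. rewrite H2. ring. }
      rewrite Cmod_mult. specialize (H1 z ltac:(lra)).
      destruct (HK z ltac:(lra)) as [_ [_ [_ HL]]].
      apply Rmult_le_compat; try apply Cmod_ge_0; [lra|].
      eapply Rle_trans; [exact HL|]. apply Rmult_le_compat_l; lra. }
  eapply Rle_trans; [exact E|].
  replace (2 * (e / (4 * K * K) * (K * r) * K) * Cmod (q - p))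
    with (e * r * (Cmod (q - p) / 2)) by (field; lra).
  assert (Cmod (q - p) <= 2 * r).
  { replace (q - p)%C with ((q - z0) + - (p - z0))%C by ring.
    eapply Rle_trans; [apply Cmod_triangle|]. rewrite Cmod_opp. lra. }
  assert (0 <= r) by (eapply Rle_trans; [apply Cmod_ge_0|exact Np]).
  replace (e * r ^ 2) with (e * r * r) by ring.
  apply Rmult_le_compat_l; nra.
Qed.

Lemma goursat_triangle (a b c : C) : D a -> D b -> D c ->
  (forall z, D z -> exists l, cdiff Llog phi z l) ->
  (S a b + S b c + S c a)%C = 0.
Proof.
  intros Ha Hb Hc Hphi.
  set (A := fun x y : R => (a + x * (b - a) + y * (c - a))%C).
  set (T := fun x y h : R => (S (A x y) (A (x + h)%R y) + S (A (x + h)%R y) (A x (y + h)%R)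
                          + S (A x (y + h)%R) (A x y))%C).
  assert (DA : forall x y, 0 <= x -> 0 <= y -> x + y <= 1 -> D (A x y)).
  (* A point of the triangle other than [a] lies on a segment from [a] to a point of the opposite
     side, so two uses of convexity suffice. *)
  { intros x y Hx Hy Hxy. destruct (Req_dec (x + y) 0) as [Z|N].
    - replace (A x y) with a; [easy|]. unfold A.
      replace x with 0 by lra. replace y with 0 by lra. ring.
    - replace (A x y) with (line a (line b c (y / (x + y))) (x + y)).
      + assert (0 <= y / (x + y) <= 1).
        { split; [apply Rdiv_le_0_compat; lra|].
          apply (Rmult_le_reg_r (x + y)); [lra|]. unfold Rdiv. rewrite Rmult_assoc, Rinv_l; lra. }
        apply line_in; try easy; [|lra]. now apply line_in.
      + unfold A. apply injective_projections; simpl; field; lra. }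
  replace (S a b + S b c + S c a)%C with (T 0 0 1).
  2:{ unfold T, A. rewrite !Rplus_0_l.
      replace (a + 0 * (b - a) + 0 * (c - a))%C with a by ring.
      replace (a + 1 * (b - a) + 0 * (c - a))%C with b by ring.
      replace (a + 0 * (b - a) + 1 * (c - a))%C with c by ring. ring. }
  apply triangle_bisection.
  - intros x y h H. unfold sub_triangle in H.
    assert (E2 : x + h / 2 + h / 2 = x + h) by field.
    assert (E3 : y + h / 2 + h / 2 = y + h) by field.
    assert (E4 : x + h / 2 + - (h / 2) = x) by field.
    assert (E5 : y + h / 2 + - (h / 2) = y) by field.
    unfold T. rewrite E2, E3, E4, E5.
    assert (X1 : D (A x y)) by (apply DA; lra).
    assert (X2 : D (A (x + h) y)) by (apply DA; lra).
    assert (X3 : D (A x (y + h))) by (apply DA; lra).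
    assert (X4 : D (A (x + h / 2) y)) by (apply DA; lra).
    assert (X5 : D (A x (y + h / 2))) by (apply DA; lra).
    assert (X6 : D (A (x + h / 2) (y + h / 2))) by (apply DA; lra).
    assert (M1 : line (A x y) (A (x + h) y) (/ 2) = A (x + h / 2) y)
      by (apply injective_projections; simpl; field).
    assert (M2 : line (A (x + h) y) (A x (y + h)) (/ 2) = A (x + h / 2) (y + h / 2))
      by (apply injective_projections; simpl; field).
    assert (M3 : line (A x (y + h)) (A x y) (/ 2) = A x (y + h / 2))
      by (apply injective_projections; simpl; field).
    (* Each outer side is cut at its midpoint; the three inner sides occur twice in opposite
       directions and cancel. *)
    rewrite (seg_split D _ _ D_convex P_cont Q_cont (A x y) (A (x + h)%R y) (/ 2)) by (easy || lra).
    rewrite (seg_split D _ _ D_convex P_cont Q_cont (A (x + h)%R y) (A x (y + h)%R) (/ 2)) by (easy || lra).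
    rewrite (seg_split D _ _ D_convex P_cont Q_cont (A x (y + h)%R) (A x y) (/ 2)) by (easy || lra).
    rewrite M1, M2, M3.
    rewrite (seg_swap D _ _ D_convex P_cont Q_cont (A (x + h / 2)%R y) (A x (y + h / 2)%R)) by easy.
    rewrite (seg_swap D _ _ D_convex P_cont Q_cont (A (x + h / 2)%R y) (A (x + h / 2)%R (y + h / 2)%R)) by easy.
    rewrite (seg_swap D _ _ D_convex P_cont Q_cont (A x (y + h / 2)%R) (A (x + h / 2)%R (y + h / 2)%R)) by easy.
    ring.
  - intros x0 y0 Hx0 Hy0 Hxy e e0.
    pose proof (DA x0 y0 Hx0 Hy0 Hxy) as Z0.
    destruct (Hphi _ Z0) as [l Hl].
    set (W := Cmod (b - a) + Cmod (c - a) + 1).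
    assert (W1 : 1 <= W).
    { unfold W. pose proof (Cmod_ge_0 (b - a)). pose proof (Cmod_ge_0 (c - a)). lra. }
    (* All vertices lie within r = 2 W |h| of the limit point, so three sides cost 3 * (e / (12
       W^2)) * (2 W |h|)^2 = e h^2. *)
    destruct (seg_log_second_order (A x0 y0) l Z0 Hl (e / (12 * W ^ 2))) as [d [Psi [d0 Hd]]].
    { apply Rdiv_lt_0_compat; nra. }
    exists (d / (2 * W)). split; [apply Rdiv_lt_0_compat; lra|].
    intros x y h H Hh Nx Ny. unfold sub_triangle in H.
    pose proof (Rabs_pos h) as h0.
    set (r := 2 * W * Rabs h).
    assert (rd : r < d).
    { unfold r. apply (Rmult_lt_compat_r (2 * W)) in Hh; [|lra].
      unfold Rdiv in Hh. rewrite Rmult_assoc, Rinv_l in Hh; lra. }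
    assert (NA : forall x y, Rabs (x - x0) <= 2 * Rabs h -> Rabs (y - y0) <= 2 * Rabs h ->
                   Cmod (A x y - A x0 y0) <= r).
    { intros x' y' H1 H2.
      replace (A x' y' - A x0 y0)%C with ((x' - x0)%R * (b - a) + (y' - y0)%R * (c - a))%C
        by (unfold A; rewrite !RtoC_minus; ring).
      eapply Rle_trans; [apply Cmod_triangle|]. rewrite !Cmod_mult, !Cmod_R.
      unfold r, W. pose proof (Cmod_ge_0 (b - a)). pose proof (Cmod_ge_0 (c - a)). nra. }
    assert (Sh : forall t t0, Rabs (t - t0) <= Rabs h -> Rabs (t - t0) <= 2 * Rabs h /\ Rabs (t + h - t0) <= 2 * Rabs h).
    { intros t t0 Ht. split; [lra|]. replace (t + h - t0) with ((t - t0) + h) by ring.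
      eapply Rle_trans; [apply Rabs_triang|]. lra. }
    destruct (Sh _ _ Nx) as [Nx1 Nx2]. destruct (Sh _ _ Ny) as [Ny1 Ny2].
    assert (X1 : D (A x y)) by (apply DA; lra).
    assert (X2 : D (A (x + h) y)) by (apply DA; lra).
    assert (X3 : D (A x (y + h))) by (apply DA; lra).
    pose proof (Hd r _ _ rd X1 X2 ltac:(auto) ltac:(auto)) as S1.
    pose proof (Hd r _ _ rd X2 X3 ltac:(auto) ltac:(auto)) as S2.
    pose proof (Hd r _ _ rd X3 X1 ltac:(auto) ltac:(auto)) as S3.
    unfold T.
    set (p1 := A x y) in *. set (p2 := A (x + h)%R y) in *. set (p3 := A x (y + h)%R) in *.
    replace (S p1 p2 + S p2 p3 + S p3 p1)%C
      with ((S p1 p2 - (Psi p2 - Psi p1)) + (S p2 p3 - (Psi p3 - Psi p2))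
            + (S p3 p1 - (Psi p1 - Psi p3)))%C by ring.
    eapply Rle_trans; [apply Cmod_triangle|].
    eapply Rle_trans; [apply Rplus_le_compat_r, Cmod_triangle|].
    replace (e * h ^ 2) with (3 * (e / (12 * W ^ 2) * r ^ 2)); [lra|].
    unfold r. rewrite <- (pow2_abs h). field. lra.
Qed.

End Convex.

(* The exceptional vertex p is cut off by a small triangle, whose contribution tends to 0. *)
Lemma goursat_exceptional_vertex (D : C -> Prop) (phi : C -> C) (p q1 q : C) :
  convex D -> (forall z, D z -> 0 < fst z) -> ccontinuous_on D phi -> D p ->
  (forall z, D z -> z <> p -> exists l, cdiff Llog phi z l) ->
  D q1 -> D q -> q1 <> p ->
  0 < (fst q - fst p) * (fst q1 - fst p) + (snd q - snd p) * (snd q1 - snd p) ->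
  let S := seg (log_dr phi) (log_dtheta phi) in
  (S p q - S p q1)%C = S q1 q.
Proof.
  intros Dc Dp Cphi Hp Hphi Hq1 Hq Nq1 Pq S.
  (* The open half-plane [0 < ip z], bounded by the line through [p] orthogonal to [q1 - p], cuts D
     in a convex set that misses [p]; the ordinary Goursat lemma applies there. *)
  set (ip := fun z : C => (fst z - fst p) * (fst q1 - fst p) + (snd z - snd p) * (snd q1 - snd p)).
  set (D0 := fun z : C => D z /\ 0 < ip z).
  assert (Pq1 : 0 < ip q1).
  { unfold ip. destruct (Req_dec (fst q1 - fst p) 0) as [E1|N1].
    2:{ pose proof (Rsqr_pos_lt _ N1) as K1. pose proof (Rle_0_sqr (snd q1 - snd p)) as K2.
      unfold Rsqr in K1, K2. lra. }
    destruct (Req_dec (snd q1 - snd p) 0) as [E2|N2].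
    2:{ pose proof (Rsqr_pos_lt _ N2) as K1. pose proof (Rle_0_sqr (fst q1 - fst p)) as K2.
      unfold Rsqr in K1, K2. lra. }
    exfalso. apply Nq1. apply injective_projections; lra. }
  change (0 < ip q) in Pq.
  assert (ipl : forall u v s, ip (line u v s) = (1 - s) * ip u + s * ip v)
    by (intros; unfold ip; simpl; ring).
  assert (ipp : ip p = 0) by (unfold ip; ring).
  assert (D0c : convex D0).
  { intros u v [Hu1 Hu2] [Hv1 Hv2] s Hs. change (D0 (line u v s)). split.
    - now apply line_in.
    - rewrite ipl. nra. }
  assert (P_cont : ccontinuous_on D (log_dr phi)).
  { intros z Hz. apply log_dr_continuous; auto. }
  assert (Q_cont : ccontinuous_on D (log_dtheta phi)).
  { intros z Hz. apply log_dtheta_continuous; auto. }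
  assert (G : forall u v w, D0 u -> D0 v -> D0 w -> (S u v + S v w + S w u)%C = 0).
  { intros u v w Hu Hv Hw. apply (goursat_triangle D0 phi D0c); try easy.
    - intros z [Hz _]. auto.
    - intros z [Hz _]. auto.
    - intros z [Hz1 Hz2]. apply Hphi; [easy|]. intros ->. lra. }
  destruct (Llog_lipschitz p (Dp p Hp)) as [K [d [K0 [d0 HK]]]].
  destruct (proj1 (ccontinuous_eps phi p) (Cphi _ Hp) 1 Rlt_0_1) as [d1 [d10 H1]].
  set (M := Cmod (phi p) + 1).
  assert (M0 : 0 < M) by (unfold M; pose proof (Cmod_ge_0 (phi p)); lra).
  set (W := Cmod (q1 - p) + Cmod (q - p) + 1).
  assert (W1 : 1 <= W).
  { unfold W. pose proof (Cmod_ge_0 (q1 - p)). pose proof (Cmod_ge_0 (q - p)). lra. }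
  assert (B : forall u v r, D u -> D v -> Cmod (u - p) <= r -> Cmod (v - p) <= r -> r < d -> r < d1 ->
    Cmod (S u v) <= 4 * (M * K) * r).
  { intros u v r Hu Hv Nu Nv rd rd1.
    assert (Cmod (S u v) <= 2 * (M * K) * Cmod (v - u)).
    { apply (seg_bound D _ _ Dc P_cont Q_cont); try easy.
      intros s Hs. set (z := line u v s).
      assert (Nz : Cmod (z - p) <= r) by now apply Cmod_line_le.
      destruct (HK z ltac:(lra)) as [K1 [K2 [K3 _]]].
      pose proof (Cmod_log_form_le phi (fun _ => RtoC 0) z K M K2 K1 K3) as F.
      unfold log_dr at 2, log_dtheta at 2 in F. 
      replace (log_dr phi z) with (log_dr phi z - 0 * RtoC (/ fst z))%C by ring.
      replace (log_dtheta phi z) with (log_dtheta phi z - 0 * Ci)%C by ring.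
      apply F. replace (phi z - 0)%C with (phi z) by ring.
      specialize (H1 z ltac:(lra)). unfold M.
      pose proof (Cmod_triangle_sub (phi z) (phi p)). lra. }
    assert (Cmod (v - u) <= 2 * r).
    { replace (v - u)%C with ((v - p) + - (u - p))%C by ring.
      eapply Rle_trans; [apply Cmod_triangle|]. rewrite Cmod_opp. lra. }
    assert (0 < M * K) by nra. nra. }
  enough (Z : (S p q - S p q1 - S q1 q)%C = 0).
  { replace (S p q - S p q1)%C with ((S p q - S p q1 - S q1 q) + S q1 q)%C by ring.
    rewrite Z. ring. }
  apply NNPP. intros N. apply Cmod_gt_0 in N.
  set (t := Cmod (S p q - S p q1 - S q1 q)) in *.
  (* The three short segments near [p] each cost at most 4 M K r with r = d2 / 2, in total at most t
     / 2, against the supposed discrepancy t. *)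
  set (d2 := Rmin (Rmin d d1) (t / (12 * (M * K)))).
  assert (MK : 0 < M * K) by nra.
  assert (d20 : 0 < d2).
  { unfold d2. repeat apply Rmin_pos; try easy. apply Rdiv_lt_0_compat; lra. }
  assert (L1 := Rmin_l (Rmin d d1) (t / (12 * (M * K)))).
  assert (L2 := Rmin_r (Rmin d d1) (t / (12 * (M * K)))).
  assert (L3 := Rmin_l d d1). assert (L4 := Rmin_r d d1). fold d2 in L1, L2.
  set (s := Rmin 1 (d2 / (2 * W))).
  assert (s0 : 0 < s).
  { apply Rmin_pos; [lra|]. apply Rdiv_lt_0_compat; lra. }
  assert (s1 : s <= 1) by apply Rmin_l.
  assert (s2 : s * W <= d2 / 2).
  { replace (d2 / 2) with (d2 / (2 * W) * W) by (field; lra).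
    apply Rmult_le_compat_r; [lra|]. apply Rmin_r. }
  set (r := d2 / 2).
  set (u := line p q1 s). set (v := line p q s).
  assert (Nu : Cmod (u - p) <= r).
  { replace (u - p)%C with (s * (q1 - p))%C
      by (apply injective_projections; simpl; ring).
    rewrite Cmod_mult, Cmod_R, Rabs_pos_eq by lra. unfold W in s2.
    pose proof (Cmod_ge_0 (q - p)). unfold r. nra. }
  assert (Nv : Cmod (v - p) <= r).
  { replace (v - p)%C with (s * (q - p))%C
      by (apply injective_projections; simpl; ring).
    rewrite Cmod_mult, Cmod_R, Rabs_pos_eq by lra. unfold W in s2.
    pose proof (Cmod_ge_0 (q1 - p)). unfold r. nra. }
  assert (Np : Cmod (p - p) <= r).
  { replace (p - p)%C with (RtoC 0) by ring. rewrite Cmod_0. unfold r. lra. }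
  assert (Du : D u) by (apply line_in; try easy; lra).
  assert (Dv : D v) by (apply line_in; try easy; lra).
  assert (D0u : D0 u) by (split; [easy|]; unfold u; rewrite ipl, ipp; nra).
  assert (D0v : D0 v) by (split; [easy|]; unfold v; rewrite ipl, ipp; nra).
  assert (D0q : D0 q) by easy. assert (D0q1 : D0 q1) by easy.
  (* The quadrilateral u, q1, q, v left after cutting off [p] is split by the diagonal from [u] to
     [q] into two triangles inside [D0]. *)
  pose proof (G u q1 q D0u D0q1 D0q) as G1.
  pose proof (G u q v D0u D0q D0v) as G2.
  pose proof (seg_swap D _ _ Dc P_cont Q_cont u q Du Hq) as E1. fold S in E1.
  pose proof (seg_swap D _ _ Dc P_cont Q_cont v q Dv Hq) as E2. fold S in E2.
  pose proof (seg_split D _ _ Dc P_cont Q_cont p q1 s Hp Hq1 ltac:(lra)) as E3. fold S u in E3.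
  pose proof (seg_split D _ _ Dc P_cont Q_cont p q s Hp Hq ltac:(lra)) as E4. fold S v in E4.
  pose proof (B p u r Hp Du Np Nu ltac:(unfold r; lra) ltac:(unfold r; lra)) as B1.
  pose proof (B p v r Hp Dv Np Nv ltac:(unfold r; lra) ltac:(unfold r; lra)) as B2.
  pose proof (B v u r Dv Du Nv Nu ltac:(unfold r; lra) ltac:(unfold r; lra)) as B3.
  assert (E : (S p q - S p q1 - S q1 q)%C = (S p v + - S p u + S v u)%C).
  { rewrite E1 in G1. rewrite E2 in G2. rewrite E3, E4.
    replace (S p v + S v q - (S p u + S u q1) - S q1 q)%C
      with (S p v - S p u + S v u - ((S u q1 + S q1 q + - S u q) + (S u q + - S v q + S v u)))%C by ring.
    rewrite G1, G2. ring. }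
  assert (t <= 3 * (4 * (M * K) * r)).
  { unfold t. rewrite E. eapply Rle_trans; [apply Cmod_triangle|].
    eapply Rle_trans; [apply Rplus_le_compat_r, Cmod_triangle|]. rewrite Cmod_opp. lra. }
  assert (d2 * (12 * (M * K)) <= t).
  { replace t with (t / (12 * (M * K)) * (12 * (M * K))) by (field; lra).
    apply Rmult_le_compat_r; lra. }
  unfold r in *. nra.
Qed.

(** The primitive integrates along segments issuing from the exceptional point itself, so only
    triangles having that point as a vertex arise. At the point, the increment identity is
    trivial. *)
Lemma primitive_exceptional_point (D : C -> Prop) (phi : C -> C) (p : C) :
  open (T := C_UniformSpace) D ->
  convex D -> (forall z, D z -> 0 < fst z) -> ccontinuous_on D phi -> D p ->
  (forall z, D z -> z <> p -> exists l, cdiff Llog phi z l) ->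
  exists Psi, forall z, D z -> is_differential Psi z (log_dr phi z) (log_dtheta phi z).
Proof.
  intros Do Dc Dp Cphi Hp Hphi.
  set (S := seg (log_dr phi) (log_dtheta phi)).
  exists (S p). intros q1 Hq1. apply is_differential_error; [auto|].
  assert (L : locally (T := C_UniformSpace) q1 (fun q => D q -> (S p q - S p q1)%C = S q1 q)).
  { destruct (Ceq_dec q1 p) as [->|N].
    - apply filter_forall. intros q Hq. unfold S. rewrite (seg_point D); try easy.
      + ring.
      + intros z Hz. apply log_dr_continuous; auto.
      + intros z Hz. apply log_dtheta_continuous; auto.
    - set (n := Cmod (q1 - p)).
      assert (n0 : 0 < n).
      { apply Cmod_gt_0. intros E. apply N. replace q1 with (q1 - p + p)%C by ring. rewrite E. ring. }
      apply locally_Cmod. exists (n / 2). split; [lra|].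
      intros q Nq Hq. apply (goursat_exceptional_vertex D); try easy.
      pose proof (Rabs_fst_le (q - q1)) as A1. pose proof (Rabs_snd_le (q - q1)) as A2.
      pose proof (Rabs_fst_le (q1 - p)) as A3. pose proof (Rabs_snd_le (q1 - p)) as A4.
      assert (E : n ^ 2 = (fst q1 - fst p) ^ 2 + (snd q1 - snd p) ^ 2).
      { unfold n. rewrite Cmod2_alt. simpl. ring. }
      (* Cauchy-Schwarz through Lagrange's identity: for |q - q1| < |q1 - p| / 2 the inner product
         of q - p with q1 - p is at least half of |q1 - p|^2, hence positive. *)
      assert (CS : ((fst q - fst q1) * (fst q1 - fst p) + (snd q - snd q1) * (snd q1 - snd p)) ^ 2
               <= Cmod (q - q1) ^ 2 * n ^ 2).
      { rewrite E, Cmod2_alt. simpl.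
        pose proof (pow2_ge_0 ((fst q - fst q1) * (snd q1 - snd p) - (snd q - snd q1) * (fst q1 - fst p))).
        nra. }
      pose proof (Cmod_ge_0 (q - q1)).
      set (X := (fst q - fst q1) * (fst q1 - fst p) + (snd q - snd q1) * (snd q1 - snd p)) in *.
      set (c := Cmod (q - q1)) in *.
      assert (n2 : 0 < n ^ 2) by (apply pow_lt; easy).
      assert (c2 : c ^ 2 <= (n / 2) ^ 2) by (apply pow_incr; lra).
      assert (B : - (n ^ 2 / 2) <= X).
      { apply Ropp_le_cancel. rewrite Ropp_involutive. apply Rsqr_incr_0_var; [|lra].
        apply (Rle_trans _ (c ^ 2 * n ^ 2)); [unfold Rsqr; lra|].
        apply (Rle_trans _ ((n / 2) ^ 2 * n ^ 2)); [apply Rmult_le_compat_r; lra|].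
        unfold Rsqr. right. field. }
      replace ((fst q - fst p) * (fst q1 - fst p) + (snd q - snd p) * (snd q1 - snd p))
        with (n ^ 2 + X) by (rewrite E; unfold X; ring).
      lra. }
  intros e e0.
  generalize (filter_and _ _ (Do q1 Hq1) (filter_and _ _ L (seg_log_first_order D phi Dc Dp Cphi q1 Hq1 e e0))).
  apply filter_imp. intros q [Hq [E1 E2]]. rewrite (E1 Hq). now apply E2.
Qed.

(** * Winding numbers in the logarithmic coordinate *)

Lemma Cinv_pair (u v : R) : u ^ 2 + v ^ 2 <> 0 ->
  (/ ((u, v) : C))%C = (u / (u ^ 2 + v ^ 2), - v / (u ^ 2 + v ^ 2)).
Proof. intros. now unfold Cinv. Qed.

Lemma ln_increment_pos r r0 : 0 < r -> 0 < r0 -> r <> r0 -> 0 < (ln r - ln r0) * (r - r0).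
Proof.
  intros H H0 N. destruct (Rtotal_order r r0) as [L|[L|L]]; [|easy|].
  - pose proof (ln_increasing r r0 H L). nra.
  - pose proof (ln_increasing r0 r H0 L). nra.
Qed.

Lemma sum_squares_pos (u v : R) : u <> 0 \/ v <> 0 -> 0 < u ^ 2 + v ^ 2.
Proof.
  intros [H|H]; apply Rsqr_pos_lt in H; unfold Rsqr in H;
    pose proof (pow2_ge_0 u); pose proof (pow2_ge_0 v); lra.
Qed.

(* (Llog q - Llog p) / (z q - z p), with z = r + i theta, has positive real part because
   the logarithm is increasing; Psi below is its principal logarithm. *)
Lemma is_differential_log_quotient (p q : C) : 0 < fst p -> 0 < fst q -> q <> p ->
  let k := fun q => (/ (Llog q - Llog p))%C in
  let m := fun q : C => (/ ((fst q - fst p)%R + Ci * (snd q - snd p)%R))%C in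
  let Psi := fun q : C =>
    let l := ln (fst q) - ln (fst p) in
    let x := fst q - fst p in let y := snd q - snd p in
    (ln (l ^ 2 + y ^ 2) / 2 - ln (x ^ 2 + y ^ 2) / 2, atan (y * (x - l) / (l * x + y ^ 2))) : C in
  is_differential Psi q (log_dr k q - m q)%C (log_dtheta k q - Ci * m q)%C.
Proof.
  intros Hp Hq N k m Psi g1 g2 t d1 d2 E D1 D2.
  set (l := ln (fst q) - ln (fst p)). set (x := fst q - fst p). set (y := snd q - snd p).
  assert (N' : x <> 0 \/ y <> 0).
  { destruct (Req_dec x 0) as [Ex|]; [|now left]. right. intros Ey.
    apply N. apply injective_projections; unfold x, y in *; lra. }
  assert (Nl : l <> 0 \/ y <> 0).
  { destruct N' as [Nx|]; [left|now right].
    pose proof (ln_increment_pos (fst q) (fst p) Hq Hp) as K. fold l x in K.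
    intros E0. rewrite E0 in K. unfold x in *. specialize (K ltac:(lra)). lra. }
  (* Multiplying l + i y by the conjugate of x + i y gives (l x + y^2) + i y (x - l); its positive
     real part is what allows [atan] for the argument. *)
  assert (W : 0 < l * x + y ^ 2).
  { destruct (Req_dec x 0) as [Ex|Nx].
    - rewrite Ex, Rmult_0_r, Rplus_0_l. destruct N' as [|Ny]; [easy|].
      apply Rsqr_pos_lt in Ny. unfold Rsqr in Ny. lra.
    - pose proof (ln_increment_pos (fst q) (fst p) Hq Hp) as K. fold l x in K.
      specialize (K ltac:(unfold x in Nx; lra)). pose proof (pow2_ge_0 y). lra. }
  pose proof (sum_squares_pos _ _ N') as X2. pose proof (sum_squares_pos _ _ Nl) as L2.
  assert (Ek : k q = (l / (l ^ 2 + y ^ 2), - y / (l ^ 2 + y ^ 2))).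
  { unfold k. rewrite <- Cinv_pair by lra. f_equal. }
  assert (Em : m q = (x / (x ^ 2 + y ^ 2), - y / (x ^ 2 + y ^ 2))).
  { unfold m. rewrite <- Cinv_pair by lra. f_equal.
    apply injective_projections; simpl; unfold x, y; ring. }
  unfold log_dr, log_dtheta. rewrite Ek, Em.
  assert (E1 : g1 t = fst q) by now rewrite <- E.
  assert (E2 : g2 t = snd q) by now rewrite <- E.
  set (r := fst q) in *.
  assert (Ex1 : ex_derive g1 t) by now exists d1.
  assert (Ex2 : ex_derive g2 t) by now exists d2.
  assert (U1 : Derive (fun x => g1 x) t = d1) by now apply is_derive_unique.
  assert (U2 : Derive (fun x => g2 x) t = d2) by now apply is_derive_unique.
  (* Real and imaginary parts of (dl + i dy) / (l + i y) - (dx + i dy) / (x + i y), with dl = d1 /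
     r, dx = d1 and dy = d2. *)
  match goal with |- is_derive _ _ ?v => replace v with (
     ((l * (d1 / r) + y * d2) / (l ^ 2 + y ^ 2) - (x * d1 + y * d2) / (x ^ 2 + y ^ 2),
      (l * d2 - y * (d1 / r)) / (l ^ 2 + y ^ 2) - (x * d2 - y * d1) / (x ^ 2 + y ^ 2)) : C) end.
  2:{ apply injective_projections; simpl; field; repeat split; simpl in *; lra. }
  unfold Psi. simpl fst. simpl snd.
  apply is_cderive_pair.
  - auto_derive.
    + rewrite E1, E2. fold l x y. simpl in X2, L2.
      repeat split; easy || (unfold l, x, y in *; simpl in *; lra).
    + rewrite E1, E2, U1, U2. fold l x y. simpl in X2, L2. fold r.
      change (ln r + - ln (fst p)) with l. change (r + - fst p) with x. change (snd q + - snd p) with y.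
      field. repeat split; simpl in *; lra.
  - auto_derive.
    + rewrite E1, E2. fold l x y. simpl in W.
      repeat split; easy || (unfold l, x, y in *; simpl in *; lra).
    + rewrite E1, E2, U1, U2. fold r.
      change (ln r + - ln (fst p)) with l. change (r + - fst p) with x. change (snd q + - snd p) with y.
      (* Multiplicativity of the squared modulus; it reconciles the denominator produced by [atan]
         with those of the two quotients. *)
      assert (NW : (l * x + y ^ 2) ^ 2 + (y * (x - l)) ^ 2 = (l ^ 2 + y ^ 2) * (x ^ 2 + y ^ 2)) by ring.
      field. simpl in *. repeat split; try lra; nra.
Qed.

(** * Cauchy's formula *)

Lemma is_CInt_plus (f g : R -> C) a b lf lg :
  is_CInt f a b lf -> is_CInt g a b lg -> is_CInt (fun t => f t + g t)%C a b (lf + lg)%C.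
Proof. apply (is_RInt_plus (V := C_R_NormedModule)). Qed.

Lemma is_CInt_mult (k : C) (f : R -> C) a b l :
  is_CInt f a b l -> is_CInt (fun t => k * f t)%C a b (k * l)%C.
Proof.
  intros H.
  pose proof (is_RInt_fct_extend_fst (U := R_NormedModule) (V := R_NormedModule) _ _ _ _ H) as H1.
  pose proof (is_RInt_fct_extend_snd (U := R_NormedModule) (V := R_NormedModule) _ _ _ _ H) as H2.
  apply (is_RInt_fct_extend_pair (U := R_NormedModule) (V := R_NormedModule)).
  - apply (is_RInt_minus (V := R_NormedModule) (fun t => fst k * fst (f t)) (fun t => snd k * snd (f t)));
      now apply (is_RInt_scal (V := R_NormedModule)).
  - apply (is_RInt_plus (V := R_NormedModule) (fun t => fst k * snd (f t)) (fun t => snd k * fst (f t)));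
      now apply (is_RInt_scal (V := R_NormedModule)).
Qed.

Lemma is_CInt_ext (f g : R -> C) a b l : a <= b ->
  (forall t, a <= t <= b -> f t = g t) -> is_CInt f a b l -> is_CInt g a b l.
Proof.
  intros ab E. apply (is_RInt_ext (V := C_R_NormedModule)).
  rewrite Rmin_left, Rmax_right by easy. intros t Ht. apply E. lra.
Qed.

Lemma is_CInt_unique (f : R -> C) a b l : is_CInt f a b l -> CInt f a b = l.
Proof. apply (is_RInt_unique (V := C_R_CompleteNormedModule)). Qed.

Lemma CInt_correct (f : R -> C) a b : ex_CInt f a b -> is_CInt f a b (CInt f a b).
Proof. apply (RInt_correct (V := C_R_CompleteNormedModule)). Qed.

Lemma is_CInt_bound (f : R -> C) a b l M : a <= b ->
  (forall t, a <= t <= b -> Cmod (f t) <= M) -> is_CInt f a b l -> Cmod l <= (b - a) * M.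
Proof.
  intros ab H I. rewrite <- Cnorm_R.
  apply (norm_RInt_le_const (V := C_R_NormedModule) f a b l M ab); [|easy].
  intros t Ht. rewrite Cnorm_R. now apply H.
Qed.

(** First-order Taylor bound for w |-> (w_t - w)^{-n}, in terms of a = 1/(w_t - w_p), b = 1/(w_t -
    w_q) and eta = w_q - w_p. [K] depends only on [m] and [n], so it is uniform along the curve. *)
Lemma inv_pow_taylor (m : R) (n : nat) : 0 <= m -> exists K, 0 <= K /\
  forall a b eta : C, Cmod a <= m -> Cmod b <= m -> (b - a)%C = (eta * a * b)%C ->
    Cmod (b ^ n - a ^ n - INR n * eta * a ^ (S n)) <= K * Cmod eta ^ 2.
Proof.
  intros m0. induction n as [|n [K [K0 IH]]].
  - exists 0. split; [lra|]. intros a b eta Ha Hb E. simpl.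
    replace (1 - 1 - 0 * eta * (a * 1))%C with (RtoC 0) by ring. rewrite Cmod_0. lra.
  - exists (m * K + INR (S n) * m ^ (n + 3)). 
    pose proof (pos_INR (S n)) as P. assert (Pm : 0 <= m ^ (n + 3)) by now apply pow_le.
    split; [nra|]. intros a b eta Ha Hb E.
    specialize (IH a b eta Ha Hb E).
    replace (b ^ S n - a ^ S n - INR (S n) * eta * a ^ S (S n))%C
      with (b * (b ^ n - a ^ n - INR n * eta * a ^ S n)
            + INR (S n) * eta ^ 2 * (a ^ S (S n) * b))%C.
    2:{ symmetry. rewrite S_INR, RtoC_plus. simpl.
        transitivity (b * (b ^ n - a ^ n - INR n * eta * (a * a ^ n))
            + (INR n + 1) * (eta * (eta * 1)) * (a * (a * a ^ n) * b)
            + (a ^ n + (INR n + 1) * eta * a * a ^ n) * ((b - a) - eta * a * b))%C; [ring|].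
        rewrite E. ring. }
    eapply Rle_trans; [apply Cmod_triangle|].
    rewrite !Cmod_mult, !Cmod_pow, Cmod_R, (Rabs_pos_eq _ P).
    rewrite Rmult_plus_distr_r. apply Rplus_le_compat.
    + rewrite Rmult_assoc. apply Rmult_le_compat; try easy; apply Cmod_ge_0.
    + replace (INR (S n) * m ^ (n + 3) * Cmod eta ^ 2)
        with (INR (S n) * Cmod eta ^ 2 * (m ^ S (S n) * m))
        by (rewrite pow_add; simpl; ring).
      pose proof (pow2_ge_0 (Cmod eta)). 
      apply Rmult_le_compat_l; [nra|].
      apply Rmult_le_compat; try easy; try apply Cmod_ge_0.
      * apply pow_le, Cmod_ge_0.
      * apply pow_incr. split; [apply Cmod_ge_0|easy].
Qed.

(* gamma^* dLlog = log_velocity gamma t dt *)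
Definition log_velocity (gamma : R -> C) (t : R) : C :=
  line_integrand gamma (log_dr (fun _ => RtoC 1)) (log_dtheta (fun _ => RtoC 1)) t.

Lemma log_velocity_form gamma phi t :
  line_integrand gamma (log_dr phi) (log_dtheta phi) t
  = (phi (gamma t) * log_velocity gamma t)%C.
Proof. unfold log_velocity, line_integrand, log_dr, log_dtheta. ring. Qed.

Section Cauchy.
Variables (D U : C -> Prop) (gamma : R -> C) (a b : R) (h : C -> C).
Hypotheses (D_open : open (T := C_UniformSpace) D) (D_convex : convex D)
  (D_pos : forall z, D z -> 0 < fst z).
Hypotheses (gamma_path : piecewise_path gamma a b) (gamma_closed : gamma a = gamma b)
  (gamma_D : forall t, a <= t <= b -> D (gamma t)).
Hypotheses (U_open : open (T := C_UniformSpace) U) (U_D : forall z, U z -> D z)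
  (gamma_U : forall t, a <= t <= b -> ~ U (gamma t)).
Hypothesis winding : forall p, U p -> winding_number gamma a b p = 1.
Hypothesis h_diff : forall z, D z -> exists l, cdiff Llog h z l.

Let ab : a <= b := piecewise_path_le gamma a b gamma_path.

Let gamma_pos t : a <= t <= b -> 0 < fst (gamma t).
Proof. auto. Qed.

Let h_cont z : D z -> ccontinuous h z.
Proof.
  intros Hz. destruct (h_diff z Hz) as [l Hl].
  apply (cdiff_continuous Llog h z l); [apply Llog_continuous; auto|easy].
Qed.

(** The inverse of [Llog] is continuous at [Llog p] and the curve misses the open set U around [p],
    so the curve keeps its distance in the variable [Llog]. Halving [d] makes the bound uniform for
    [q] near [p]. *)
Lemma Llog_gap p : U p -> exists d, 0 < d /\
  locally (T := C_UniformSpace) p (fun q => U q /\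
    forall t, a <= t <= b -> d <= Cmod (Llog (gamma t) - Llog q)).
Proof.
  intros Hp.
  pose proof (D_pos p (U_D p Hp)) as p0.
  destruct (proj1 (locally_Cmod _ _) (U_open p Hp)) as [r [r0 Hr]].
  set (inv := fun w : C => (exp (fst w), snd w) : C).
  assert (Ei : forall q, 0 < fst q -> inv (Llog q) = q).
  { intros q Hq. unfold inv, Llog. simpl. rewrite exp_ln by easy. symmetry. apply C_surjective. }
  assert (Ci : ccontinuous inv (Llog p)).
  { apply ccontinuous_pair.
    - apply (continuous_comp (U := C_UniformSpace) fst exp).
      + apply (continuous_fst (U := R_UniformSpace) (V := R_UniformSpace)).
      + apply continuous_exp.
    - apply (continuous_snd (U := R_UniformSpace) (V := R_UniformSpace)). }
  destruct (proj1 (ccontinuous_eps _ _) Ci r r0) as [d [d0 Hd]].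
  assert (Far : forall t, a <= t <= b -> d <= Cmod (Llog (gamma t) - Llog p)).
  { intros t Ht. apply Rnot_lt_le. intros L. apply Hd in L.
    rewrite !Ei in L by auto. now apply (gamma_U t Ht), Hr. }
  destruct (proj1 (ccontinuous_eps _ _) (Llog_continuous p p0) (d / 2)) as [r' [r'0 Hr']]; [lra|].
  exists (d / 2). split; [lra|]. apply locally_Cmod. exists (Rmin r r'). split; [now apply Rmin_pos|].
  intros q Hq. pose proof (Rmin_l r r'). pose proof (Rmin_r r r'). split; [apply Hr; lra|].
  intros t Ht. specialize (Far t Ht). specialize (Hr' q ltac:(lra)).
  replace (Llog (gamma t) - Llog q)%C
    with ((Llog (gamma t) - Llog p) - (Llog q - Llog p))%C by ring.
  pose proof (Cmod_triangle_sub (Llog (gamma t) - Llog p) (Llog q - Llog p)). lra.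
Qed.

Lemma Llog_neq p t : U p -> a <= t <= b -> (Llog (gamma t) - Llog p)%C <> 0.
Proof.
  intros Hp Ht. destruct (Llog_gap p Hp) as [d [d0 Hd]].
  apply locally_singleton in Hd. destruct Hd as [_ Hd].
  apply Cmod_gt_0. specialize (Hd t Ht). lra.
Qed.

Lemma form_integrable (phi : C -> C) :
  (forall t, a <= t <= b -> ccontinuous phi (gamma t)) ->
  ex_CInt (fun t => phi (gamma t) * log_velocity gamma t)%C a b /\
  exists M, forall t, a <= t <= b -> Cmod (phi (gamma t) * log_velocity gamma t) <= M.
Proof.
  intros H.
  destruct (line_integrand_regular gamma (log_dr phi) (log_dtheta phi) a b gamma_path) as [I [M HM]].
  { intros t Ht. split; [apply log_dr_continuous|apply log_dtheta_continuous]; auto. }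
  split.
  - apply (ex_RInt_ext (V := C_R_NormedModule) (line_integrand gamma (log_dr phi) (log_dtheta phi))); [|easy].
    intros t _. apply log_velocity_form.
  - exists M. intros t Ht. rewrite <- log_velocity_form. now apply HM.
Qed.

Lemma kernel_continuous p n t : U p -> a <= t <= b ->
  ccontinuous (fun q => / (Llog q - Llog p) ^ n)%C (gamma t).
Proof.
  intros Hp Ht. apply ccontinuous_inv; [now apply Cpow_nz, Llog_neq|].
  apply ccontinuous_pow. apply ccontinuous_minus; [apply Llog_continuous; auto|apply ccontinuous_const].
Qed.

(** The two kernels differ by the differential of a logarithm of their quotient, whose integral
    along the closed curve vanishes. *)
Lemma winding_log p : U p ->
  is_CInt (fun t => / (Llog (gamma t) - Llog p) * log_velocity gamma t)%C a b (2 * PI * Ci)%C.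
Proof.
  intros Hp.
  assert (pi0 : (2 * PI * Ci)%C <> 0).
  { repeat apply Cmult_neq_0.
    - intros E. apply RtoC_inj in E. lra.
    - intros E. apply RtoC_inj in E. pose proof PI_RGT_0. lra.
    - intros E. apply (f_equal snd) in E. simpl in E. lra. }
  assert (N : forall t, a <= t <= b -> gamma t <> p).
  { intros t Ht E. apply (gamma_U t Ht). now rewrite E. }
  set (m := fun q : C => (/ ((fst q - fst p)%R + Ci * (snd q - snd p)%R))%C).
  set (k := fun q => (/ (Llog q - Llog p))%C).
  assert (Cm : forall t, a <= t <= b -> ccontinuous m (gamma t)).
  { intros t Ht. apply ccontinuous_inv.
    - intros E. apply (N t Ht). pose proof (f_equal fst E) as E1. pose proof (f_equal snd E) as E2.
      simpl in E1, E2. apply injective_projections; lra.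
    - apply (ccontinuous_ext_loc (fun q => q - p)%C).
      + apply filter_forall. intros q. apply injective_projections; simpl; ring.
      + apply ccontinuous_minus; [apply continuous_id|apply ccontinuous_const]. }
  assert (Ck : forall t, a <= t <= b -> ccontinuous k (gamma t)).
  { intros t Ht. apply ccontinuous_inv; [now apply Llog_neq|].
    apply ccontinuous_minus; [apply Llog_continuous; auto|apply ccontinuous_const]. }
  pose proof (winding p Hp) as W. unfold winding_number, line_integral in W.
  destruct (line_integrand_regular gamma m (fun q => Ci * m q)%C a b gamma_path) as [I _].
  { intros t Ht. split; [auto|]. apply ccontinuous_mult; [apply ccontinuous_const|auto]. }
  assert (Iv : CInt (line_integrand gamma m (fun q => Ci * m q)%C) a b = (2 * PI * Ci)%C).
  { set (v := CInt _ a b). change (/ (2 * PI * Ci) * v = 1)%C in W.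
    replace v with (2 * PI * Ci * (/ (2 * PI * Ci) * v))%C by (field; repeat split; intros Z; apply pi0; rewrite Z; ring).
    rewrite W. as_C; ring. }
  assert (I' : is_CInt (line_integrand gamma m (fun q => Ci * m q)%C) a b (2 * PI * Ci)%C)
    by (rewrite <- Iv; now apply CInt_correct).
  clear I.
  pose proof (line_integral_exact gamma _ (fun q => log_dr k q - m q)%C
    (fun q => log_dtheta k q - Ci * m q)%C a b gamma_path
    (fun t Ht => conj (is_differential_log_quotient p (gamma t) (D_pos p (U_D p Hp)) (gamma_pos t Ht) (N t Ht))
      (conj (ccontinuous_minus _ _ _ (log_dr_continuous _ _ (gamma_pos t Ht) (Ck t Ht)) (Cm t Ht))
        (ccontinuous_minus _ _ _ (log_dtheta_continuous _ _ (Ck t Ht))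
          (ccontinuous_mult _ _ _ (ccontinuous_const Ci _) (Cm t Ht)))))) as J.
  cbv beta zeta in J. rewrite gamma_closed in J.
  pose proof (is_CInt_plus _ _ _ _ _ _ J I') as K.
  match type of K with is_RInt _ _ _ ?v => replace v with (2 * PI * Ci)%C in K by (as_C; ring) end.
  revert K. apply is_CInt_ext; [easy|]. intros t Ht.
  transitivity (k (gamma t) * log_velocity gamma t)%C; [|easy].
  rewrite <- log_velocity_form. unfold line_integrand. ring.
Qed.

Lemma cauchy_formula p : U p ->
  is_CInt (fun t => h (gamma t) * / (Llog (gamma t) - Llog p) * log_velocity gamma t)%C a b
    (2 * PI * Ci * h p)%C.
Proof.
  intros Hp. pose proof (U_D p Hp) as Dp. pose proof (D_pos p Dp) as p0.
  destruct (h_diff p Dp) as [l [rho [R1 [R2 R3]]]].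
  set (phi := fun q => if Ceq_dec q p then l else ((h q - h p) / (Llog q - Llog p))%C).
  assert (Np : forall q, D q -> q <> p -> (Llog q - Llog p)%C <> 0).
  { intros q Hq N E. apply N, Llog_inj; auto.
    replace (Llog q) with (Llog q - Llog p + Llog p)%C by ring. rewrite E. ring. }
  assert (Hphi : forall z, D z -> z <> p -> exists l, cdiff Llog phi z l).
  { intros z Hz N. destruct (h_diff z Hz) as [lz Hlz].
    pose proof (Llog_continuous z (D_pos z Hz)) as CL.
    eexists. apply (cdiff_ext_loc _ (fun q => (h q + - h p) * / (Llog q + - Llog p))%C).
    - assert (Nz : (z - p)%C <> 0).
      { intros E. apply N. replace z with (z - p + p)%C by ring. rewrite E. ring. }
      generalize (ccontinuous_neq (fun q => q - p)%C z
        (ccontinuous_minus _ _ _ (continuous_id z) (ccontinuous_const p z)) Nz).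
      apply filter_imp. intros q Nq. unfold phi.
      destruct (Ceq_dec q p) as [->|]; [|easy]. exfalso. apply Nq. ring.
    - apply cdiff_mult; [easy| |].
      + apply cdiff_plus; [exact Hlz|apply cdiff_const].
      + apply cdiff_inv; [easy|now apply Np|].
        apply cdiff_plus; [apply cdiff_self|apply cdiff_const]. }
  assert (Cphi : ccontinuous_on D phi).
  { intros z Hz. destruct (Ceq_dec z p) as [->|N].
    (* Near [p] the completed quotient is just the slope function of [h], so continuity at [p] comes
       from [cdiff] directly. *)
    - apply (ccontinuous_ext_loc rho); [|easy].
      generalize (filter_and _ _ (D_open p Dp) R1). apply filter_imp. intros q [Hq E].
      unfold phi. destruct (Ceq_dec q p) as [->|Nq]; [easy|].
      rewrite E. field. now apply Np.
    - destruct (Hphi z Hz N) as [lz Hlz].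
      apply (cdiff_continuous Llog _ _ lz); [apply Llog_continuous; auto|easy]. }
  destruct (primitive_exceptional_point D phi p D_open D_convex D_pos Cphi Dp Hphi) as [Psi HPsi].
  pose proof (line_integral_exact gamma Psi (log_dr phi) (log_dtheta phi) a b gamma_path
    (fun t Ht => conj (HPsi _ (gamma_D t Ht))
      (conj (log_dr_continuous _ _ (gamma_pos t Ht) (Cphi _ (gamma_D t Ht)))
            (log_dtheta_continuous _ _ (Cphi _ (gamma_D t Ht)))))) as J.
  rewrite gamma_closed in J.
  pose proof (is_CInt_plus _ _ _ _ _ _ J (is_CInt_mult (h p) _ _ _ _ (winding_log p Hp))) as K.
  match type of K with is_RInt _ _ _ ?v => replace v with (2 * PI * Ci * h p)%C in K by (as_C; ring) end.
  revert K. apply is_CInt_ext; [easy|]. intros t Ht.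
  rewrite log_velocity_form. unfold phi.
  destruct (Ceq_dec (gamma t) p) as [E|N].
  - exfalso. apply (gamma_U t Ht). now rewrite E.
  - field. now apply Llog_neq.
Qed.

Definition cauchy_integral (n : nat) (p : C) : C :=
  CInt (fun t => h (gamma t) * / (Llog (gamma t) - Llog p) ^ n * log_velocity gamma t)%C a b.

Lemma is_CInt_cauchy_integral n p : U p ->
  is_CInt (fun t => h (gamma t) * / (Llog (gamma t) - Llog p) ^ n * log_velocity gamma t)%C a b
    (cauchy_integral n p).
Proof.
  intros Hp. apply CInt_correct.
  apply (form_integrable (fun q => h q * / (Llog q - Llog p) ^ n)%C).
  intros t Ht. apply ccontinuous_mult; [auto|now apply kernel_continuous].
Qed.

Lemma cdiff_cauchy_integral n p : U p ->
  cdiff Llog (cauchy_integral n) p (INR n * cauchy_integral (S n) p).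
Proof.
  intros Hp. apply cdiff_of_error. intros e e0.
  destruct (Llog_gap p Hp) as [d [d0 Hd]].
  destruct (form_integrable h ltac:(auto)) as [_ [M HM]].
  assert (M0 : 0 <= M) by (eapply Rle_trans; [apply Cmod_ge_0|apply (HM a); lra]).
  assert (i0 : 0 < / d) by now apply Rinv_0_lt_compat.
  destruct (inv_pow_taylor (/ d) n) as [K [K0 HK]]; [lra|].
  (* The integrated remainder is at most (b - a) M K |eta|^2, which is at most e |eta| once |eta| <
     e / B; the added 1 keeps [B] positive. *)
  set (B := (b - a) * (M * K) + 1).
  assert (MK : 0 <= M * K) by now apply Rmult_le_pos.
  assert (B0 : 0 < B) by (unfold B; nra).
  pose proof (Llog_continuous p (D_pos p (U_D p Hp))) as CL.
  assert (Sm : locally (T := C_UniformSpace) p (fun q => Cmod (Llog q - Llog p) < e / B)).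
  { apply locally_Cmod. apply (proj1 (ccontinuous_eps _ _) CL). now apply Rdiv_lt_0_compat. }
  pose proof (locally_singleton _ _ Hd) as [_ Hdp].
  generalize (filter_and _ _ Hd Sm). apply filter_imp. intros q [[Uq Hdq] Hq].
  set (eta := (Llog q - Llog p)%C) in *.
  pose proof (is_CInt_plus _ _ _ _ _ _ (is_CInt_cauchy_integral n q Uq)
    (is_CInt_plus _ _ _ _ _ _ (is_CInt_mult (- (1)) _ _ _ _ (is_CInt_cauchy_integral n p Hp))
      (is_CInt_mult (- (INR n * eta)) _ _ _ _ (is_CInt_cauchy_integral (S n) p Hp)))) as I.
  apply (is_CInt_bound _ _ _ _ (M * K * Cmod eta ^ 2)) in I; [|easy|].
  - match type of I with Cmod ?v <= _ => replace v with
      (cauchy_integral n q - cauchy_integral n p - INR n * cauchy_integral (S n) p * eta)%C in I by (as_C; ring) end.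
    eapply Rle_trans; [exact I|].
    pose proof (Cmod_ge_0 eta).
    assert (Hq' : B * Cmod eta <= e).
    { replace e with (B * (e / B)) by (field; lra). apply Rmult_le_compat_l; lra. }
    unfold B in Hq'. nra.
  - intros t Ht. specialize (HM t Ht). specialize (Hdp t Ht). specialize (Hdq t Ht).
    pose proof (Llog_neq p t Hp Ht) as N1. pose proof (Llog_neq q t Uq Ht) as N2.
    set (x := (/ (Llog (gamma t) - Llog p))%C). set (y := (/ (Llog (gamma t) - Llog q))%C).
    assert (Hx : Cmod x <= / d) by (unfold x; rewrite Cmod_inv by easy; now apply Rinv_le_contravar).
    assert (Hy : Cmod y <= / d) by (unfold y; rewrite Cmod_inv by easy; now apply Rinv_le_contravar).
    specialize (HK x y eta Hx Hy). rewrite <- !Cpow_inv by easy. fold x y.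
    replace (h (gamma t) * y ^ n * log_velocity gamma t +
      (- (1) * (h (gamma t) * x ^ n * log_velocity gamma t) +
       - (INR n * eta) * (h (gamma t) * x ^ S n * log_velocity gamma t)))%C
      with (h (gamma t) * log_velocity gamma t * (y ^ n - x ^ n - INR n * eta * x ^ S n))%C by ring.
    rewrite Cmod_mult, Rmult_assoc. apply Rmult_le_compat; try apply Cmod_ge_0; [easy|].
    apply HK. unfold x, y, eta. field. easy.
Qed.

End Cauchy.

(** * Polar derivatives *)

(** r e^{i theta} is periodic in theta, so injectivity is only local: near [p] the increment of
    [Llog] is a multiple of that of [polar_point], and [Llog] is injective. *)
Lemma locally_polar_point_neq p : 0 < fst p ->
  locally (T := C_UniformSpace) p (fun q => q <> p -> (polar_point q - polar_point p)%C <> 0).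
Proof.
  intros Hp.
  destruct (cdiff_inverse polar_point Llog p _ (polar_point_neq_0 p Hp) (cdiff_polar_point p Hp)
    : cdiff polar_point Llog p (/ polar_point p)) as [s [S1 _]].
  generalize (filter_and _ _ (locally_fst_pos p Hp) S1). apply filter_imp.
  intros q [Hq E] N Z. apply N, Llog_inj; [easy|easy|]. rewrite Z in E.
  replace (Llog q) with (Llog q - Llog p + Llog p)%C by ring. rewrite E. ring.
Qed.

Lemma is_Dpol_iff f p l : 0 < fst p ->
  is_Dpol f p l <-> cdiff polar_point f p l.
Proof.
  intros Hp. pose proof (locally_polar_point_neq p Hp) as N.
  split.
  - intros H.
    exists (fun q => if Ceq_dec q p then l else ((f q - f p) / (polar_point q - polar_point p))%C).
    split; [|split].
    + revert N. apply filter_imp. intros q Nq. destruct (Ceq_dec q p) as [->|E]; [ring|].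
      field. now apply Nq.
    + intros V HV. destruct (Ceq_dec p p) as [_|]; [|easy].
      pose proof (H V HV) as K.
      change (locally (T := C_UniformSpace) p
        (fun q => q <> p -> V ((f q - f p) / (polar_point q - polar_point p))%C)) in K.
      match goal with |- filtermap ?g _ _ =>
        change (locally (T := C_UniformSpace) p (fun q => V (g q))) end.
      revert K. apply filter_imp. intros q Hq. cbv beta.
      destruct (Ceq_dec q p) as [->|E]; [|now apply Hq].
      now apply (locally_singleton (T := C_UniformSpace)) in HV.
    + now destruct (Ceq_dec p p).
  - intros [rho [R1 [R2 R3]]] V HV. rewrite <- R3 in HV.
    change (locally (T := C_UniformSpace) p
      (fun q => q <> p -> V ((f q - f p) / (polar_point q - polar_point p))%C)).
    generalize (filter_and _ _ N (filter_and _ _ R1 (R2 V HV))).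
    apply filter_imp. intros q [Nq [E Hq]] Hqp.
    rewrite E. replace (rho q * (polar_point q - polar_point p) / (polar_point q - polar_point p))%C
      with (rho q) by (field; now apply Nq). exact Hq.
Qed.

Lemma cdiff_polar_of_log f p l : 0 < fst p ->
  cdiff Llog f p l -> cdiff polar_point f p (l * / polar_point p).
Proof.
  intros Hp H. apply (cdiff_comp Llog polar_point f p _ _); [|easy|].
  - apply (cdiff_continuous Llog _ _ (polar_point p)); [now apply Llog_continuous|].
    now apply cdiff_polar_point.
  - apply cdiff_inverse; [now apply polar_point_neq_0|now apply cdiff_polar_point].
Qed.

Lemma cdiff_log_of_polar f p l : 0 < fst p ->
  cdiff polar_point f p l -> cdiff Llog f p (l * polar_point p).
Proof.
  intros Hp H. apply (cdiff_comp polar_point); [now apply Llog_continuous|easy|].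
  now apply cdiff_polar_point.
Qed.

Lemma cdiff_Llog_unique f p l m : 0 < fst p -> cdiff Llog f p l -> cdiff Llog f p m -> l = m.
Proof. intros Hp. apply cdiff_unique. now apply Llog_nonconst. Qed.

(** [iota] returns the limit once it is known to be unique; uniqueness is read off in the coordinate
    [Llog]. *)
Lemma Dpol_cdiff f p l : 0 < fst p -> cdiff polar_point f p l -> Dpol f p = l.
Proof.
  intros Hp H. unfold Dpol.
  apply (iota_unique (V := C_R_CompleteNormedModule)).
  - intros m Hm. apply is_Dpol_iff in Hm; [|easy].
    pose proof (cdiff_log_of_polar _ _ _ Hp Hm) as H1.
    pose proof (cdiff_log_of_polar _ _ _ Hp H) as H2.
    pose proof (cdiff_Llog_unique _ _ _ _ Hp H1 H2) as E.
    pose proof (polar_point_neq_0 p Hp) as N.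
    replace m with ((m * polar_point p) / polar_point p)%C by (field; easy).
    rewrite E. as_C. field. easy.
  - now apply is_Dpol_iff.
Qed.

Lemma polar_power_plus x y p : polar_power (x + y) p = (polar_power x p * polar_power y p)%C.
Proof.
  rewrite !polar_power_cexp, <- cexp_plus. f_equal. rewrite RtoC_plus. ring.
Qed.

Lemma polar_power_0 p : polar_power 0 p = 1.
Proof.
  rewrite polar_power_cexp. replace (0%R * Llog p)%C with (RtoC 0) by ring.
  apply injective_projections; simpl; rewrite exp_0, ?cos_0, ?sin_0; ring.
Qed.

Lemma polar_point_inv p : 0 < fst p -> (/ polar_point p)%C = polar_power (-1) p.
Proof.
  intros Hp. pose proof (polar_point_neq_0 p Hp) as N.
  replace (polar_power (-1) p) with (polar_power (-1) p * polar_point p / polar_point p)%C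
    by (field; easy).
  rewrite polar_point_power at 2 by easy.
  rewrite <- polar_power_plus. replace (-1 + 1) with 0 by ring. rewrite polar_power_0.
  field. easy.
Qed.

Lemma cis_pow x j : cis (INR j * x) = (cis x ^ j)%C.
Proof.
  induction j as [|j IH].
  - simpl. rewrite Rmult_0_l. unfold cis. now rewrite cos_0, sin_0.
  - rewrite S_INR. simpl. rewrite <- IH.
    replace ((INR j + 1) * x) with (x + INR j * x) by ring.
    unfold cis. apply injective_projections; simpl; rewrite ?cos_plus, ?sin_plus; ring.
Qed.

Definition csum (X : nat -> C) (n : nat) : C := sum_n (G := C_AbelianGroup) X n.

Lemma Theta_eq c k f p :
  Theta c k f p = csum
    (fun j => RtoC (Stirling c k j) * (polar_point p ^ j * Dpol_n j f p))%C k.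
Proof.
  unfold Theta, csum. apply sum_n_ext. intros j. unfold polar_point.
  rewrite Cpow_mult_l, <- cis_pow, <- RtoC_pow. as_C. ring.
Qed.

Lemma csum_S (X : nat -> C) n :
  csum X (S n) = (csum X n + X (S n))%C.
Proof. apply (sum_Sn (G := C_AbelianGroup)). Qed.

Lemma csum_0 (X : nat -> C) : csum X 0 = X O.
Proof. apply (sum_O (G := C_AbelianGroup)). Qed.

Lemma Stirling_above c k : forall j, (k < j)%nat -> Stirling c k j = 0.
Proof.
  induction k as [|k IH]; intros [|j] H; simpl; try lia; try easy.
  rewrite !IH by lia. ring.
Qed.

Lemma Stirling_sum c k (X : nat -> C) :
  csum
    (fun j => RtoC (Stirling c k j) * ((c + INR j)%R * X j + X (S j)))%C k
  = csum (fun j => RtoC (Stirling c (S k) j) * X j)%C (S k).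
Proof.
  (* Shifting the index in the truncated sum leaves one boundary term, which vanishes at [m = k]
     because S_c(k, k + 1) = 0. *)
  assert (H : forall m, (csum
      (fun j => RtoC (Stirling c k j) * ((c + INR j)%R * X j + X (S j))) m
      + (c + INR (S m))%R * Stirling c k (S m) * X (S m)
    = csum (fun j => RtoC (Stirling c (S k) j) * X j) (S m))%C).
  { induction m as [|m IH].
    - rewrite csum_S, !csum_0. simpl.
      rewrite ?RtoC_plus, ?RtoC_mult, ?RtoC_plus. as_C. ring.
    - rewrite csum_S, (csum_S _ (S m)), <- IH.
      change (Stirling c (S k) (S (S m)))
        with (Stirling c k (S m) + (c + INR (S (S m))) * Stirling c k (S (S m)))%R.
      rewrite ?RtoC_plus, ?RtoC_mult, ?RtoC_plus. as_C. ring. }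
  rewrite <- H. rewrite (Stirling_above c k (S k)) by lia. as_C. ring.
Qed.

Lemma cdiff_csum L (g g' : nat -> C -> C) p n :
  (forall j, cdiff L (g j) p (g' j p)) ->
  cdiff L (fun q => csum (fun j => g j q) n) p
    (csum (fun j => g' j p) n).
Proof.
  intros H. induction n as [|n IH].
  - rewrite csum_0. apply (cdiff_ext _ (g O)); [|easy]. intros q. now rewrite csum_0.
  - rewrite csum_S.
    apply (cdiff_ext _ (fun q => csum (fun j => g j q) n + g (S n) q)%C).
    + intros q. now rewrite csum_S.
    + now apply cdiff_plus.
Qed.

Lemma cdiff_pow L f p l n : ccontinuous L p -> cdiff L f p l ->
  cdiff L (fun q => f q ^ n)%C p (INR n * l * f p ^ (n - 1)).
Proof.
  intros HL H. induction n as [|n IH].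
  - simpl. replace (0 * l * 1)%C with (RtoC 0) by ring. apply cdiff_const.
  - replace (INR (S n) * l * f p ^ (S n - 1))%C
      with (l * f p ^ n + f p * (INR n * l * f p ^ (n - 1)))%C.
    + now apply (cdiff_mult L f (fun q => f q ^ n)%C).
    + rewrite S_INR, RtoC_plus. replace (S n - 1)%nat with n by lia.
      destruct n as [|n]; simpl; [ring|]. rewrite Nat.sub_0_r. ring.
Qed.

(** * Iterated polar derivatives of f, and their Stirling sums *)

Section Iterates.
Variables (U : C -> Prop) (f : C -> C) (c : R) (E : nat -> C -> C).
Hypotheses (U_open : open (T := C_UniformSpace) U) (U_pos : forall z, U z -> 0 < fst z).
Hypothesis E_0 : forall p, U p -> E O p = f p.
Hypothesis E_diff : forall n p, U p -> cdiff Llog (E n) p (E (S n) p - c * E n p).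

(** Records only the shape of the iterates of [Dpol]. The span is stable under d/dLlog, which sends
    E_n z^x to E_{n+1} z^x + (x - c) E_n z^x, and under division by z, which lowers x by 1; here z =
    r e^{i theta}. *)
Inductive polar_span : (C -> C) -> Prop :=
| span_base n x : polar_span (fun p => E n p * polar_power x p)%C
| span_plus g h : polar_span g -> polar_span h -> polar_span (fun p => g p + h p)%C
| span_scal (k : C) g : polar_span g -> polar_span (fun p => k * g p)%C.

Lemma polar_span_shift g : polar_span g ->
  exists g', polar_span g' /\ forall p, U p -> g' p = (g p * / polar_point p)%C.
Proof.
  induction 1 as [n x|g h Hg [g' [G1 G2]] Hh [h' [H1 H2]]|k g Hg [g' [G1 G2]]].
  - exists (fun p => E n p * polar_power (x + -1) p)%C. split; [constructor|].
    intros p Hp. rewrite polar_power_plus, polar_point_inv by auto. ring.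
  - exists (fun p => g' p + h' p)%C. split; [now constructor|].
    intros p Hp. rewrite G2, H2 by easy. ring.
  - exists (fun p => k * g' p)%C. split; [now constructor|].
    intros p Hp. rewrite G2 by easy. ring.
Qed.

Lemma polar_span_log_derivative g : polar_span g ->
  exists g', polar_span g' /\ forall p, U p -> cdiff Llog g p (g' p).
Proof.
  induction 1 as [n x|g h Hg [g' [G1 G2]] Hh [h' [H1 H2]]|k g Hg [g' [G1 G2]]].
  - exists (fun p => E (S n) p * polar_power x p + (x - c)%R * (E n p * polar_power x p))%C.
    split; [repeat constructor|].
    intros p Hp.
    replace (E (S n) p * polar_power x p + (x - c)%R * (E n p * polar_power x p))%C
      with ((E (S n) p - c * E n p) * polar_power x p + E n p * (x * polar_power x p))%C
      by (rewrite RtoC_minus; ring).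
    apply cdiff_mult; [now apply Llog_continuous, U_pos|auto|auto using cdiff_polar_power].
  - exists (fun p => g' p + h' p)%C. split; [now constructor|].
    intros p Hp. apply cdiff_plus; auto.
  - exists (fun p => k * g' p)%C. split; [now constructor|].
    intros p Hp. apply cdiff_scal; [now apply Llog_continuous, U_pos|auto].
Qed.

Lemma polar_span_Dpol g : polar_span g ->
  exists g', polar_span g' /\ forall p, U p -> cdiff polar_point g p (g' p).
Proof.
  intros Hg. destruct (polar_span_log_derivative g Hg) as [g1 [S1 D1]].
  destruct (polar_span_shift g1 S1) as [g2 [S2 E2]].
  exists g2. split; [easy|]. intros p Hp. rewrite E2 by easy.
  apply cdiff_polar_of_log; auto.
Qed.

(** The equality holds on the open set U, hence on a neighbourhood of each of its points; this lets
    the derivative of [g] be transferred to the iterate and the induction proceed. *)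
Lemma Dpol_n_span j : exists g, polar_span g /\ forall p, U p -> Dpol_n j f p = g p.
Proof.
  induction j as [|j [g [S1 H1]]].
  - exists (fun p => E O p * polar_power 0 p)%C. split; [constructor|].
    intros p Hp. rewrite polar_power_0, E_0 by easy. simpl. ring.
  - destruct (polar_span_Dpol g S1) as [g' [S2 H2]]. exists g'. split; [easy|].
    intros p Hp. apply Dpol_cdiff; [auto|].
    apply (cdiff_ext_loc _ g); [|auto].
    generalize (U_open p Hp). apply filter_imp. intros q Hq. symmetry. now apply H1.
Qed.

Lemma Dpol_n_cdiff j p : U p -> cdiff polar_point (Dpol_n j f) p (Dpol_n (S j) f p).
Proof.
  intros Hp. destruct (Dpol_n_span j) as [g [S1 H1]].
  destruct (polar_span_Dpol g S1) as [g' [_ H2]].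
  assert (H : cdiff polar_point (Dpol_n j f) p (g' p)).
  { apply (cdiff_ext_loc _ g); [|auto].
    generalize (U_open p Hp). apply filter_imp. intros q Hq. symmetry. now apply H1. }
  change (Dpol_n (S j) f p) with (Dpol (Dpol_n j f) p).
  now rewrite (Dpol_cdiff _ _ _ (U_pos p Hp) H).
Qed.

(** The Stirling sum for [k] is differentiated term by term in [Llog], with z^j Dpol^j f going to j
    z^j Dpol^j f + z^{j+1} Dpol^{j+1} f, and the result is matched with the recurrence of [E] by
    uniqueness. *)
Lemma Theta_iterate k p : U p -> Theta c k f p = E k p.
Proof.
  revert p. induction k as [|k IH]; intros p Hp.
  - rewrite Theta_eq, csum_0. simpl. rewrite E_0 by easy. ring.
  - pose proof (U_pos p Hp) as p0. pose proof (Llog_continuous p p0) as CL.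
    set (X := fun j q => (polar_point q ^ j * Dpol_n j f q)%C).
    assert (DX : forall j, cdiff Llog (X j) p (INR j * X j p + X (S j) p)%C).
    { intros j. unfold X.
      replace (INR j * (polar_point p ^ j * Dpol_n j f p) + polar_point p ^ S j * Dpol_n (S j) f p)%C
        with ((INR j * polar_point p * polar_point p ^ (j - 1)) * Dpol_n j f p
              + polar_point p ^ j * (Dpol_n (S j) f p * polar_point p))%C.
      2:{ destruct j as [|j]; [simpl; ring|].
          replace (S j - 1)%nat with j by lia. rewrite !Cpow_S. ring. }
      apply (cdiff_mult Llog (fun q => polar_point q ^ j)%C); [easy| |].
      - apply cdiff_pow; [easy|now apply cdiff_polar_point].
      - apply cdiff_log_of_polar; [easy|now apply Dpol_n_cdiff]. }
    pose proof (cdiff_csum Llog (fun j q => RtoC (Stirling c k j) * X j q)%C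
      (fun j q => RtoC (Stirling c k j) * (INR j * X j q + X (S j) q))%C p k
      (fun j => cdiff_scal _ _ _ _ _ CL (DX j))) as DS.
    assert (DE : cdiff Llog (E k) p (csum
      (fun j => RtoC (Stirling c k j) * (INR j * X j p + X (S j) p))%C k)).
    { refine (cdiff_ext_loc _ _ _ _ _ _ DS). generalize (U_open p Hp). apply filter_imp.
      intros q Hq. rewrite <- IH by easy. now rewrite Theta_eq. }
    pose proof (cdiff_Llog_unique _ _ _ _ p0 DE (E_diff k p Hp)) as Eq.
    rewrite Theta_eq. change (fun j => (RtoC (Stirling c (S k) j) * (polar_point p ^ j * Dpol_n j f p))%C)
      with (fun j => (RtoC (Stirling c (S k) j) * X j p)%C).
    rewrite <- (Stirling_sum c k (fun j => X j p)).
    replace (E (S k) p) with ((E (S k) p - c * E k p) + c * E k p)%C by ring.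
    rewrite <- Eq, <- (IH p Hp), Theta_eq.
    (* Only the upper limits of summation are generalized; the index [k] inside the Stirling numbers
       stays fixed. Adding c times the sum turns the factor j into c + j. *)
    clear. generalize k at 2 4 6. intros n.
    induction n as [|n IHn].
    + rewrite !csum_0. fold (X O p). rewrite RtoC_plus. ring.
    + rewrite !csum_S, IHn. fold (X (S n) p). rewrite RtoC_plus. ring.
Qed.

End Iterates.

(** * Cauchy's formula for h in the variable [Llog], read back in terms of [f] and [Theta] *)

Lemma boundary_of_open (U : C -> Prop) p : open (T := C_UniformSpace) U -> boundary U p -> ~ U p.
Proof.
  intros HU Hb Hp. destruct (Hb U (HU p Hp)) as [_ [q [H1 H2]]]. easy.
Qed.

Theorem theorem4
  (D : R * R -> Prop) (f : R * R -> C)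
  (gamma : R -> R * R) (a b : R) (U : R * R -> Prop)
  (p0 : R * R) (c : R) (k : nat)
  (D_domain : is_domain D) (D_sub_H : contained D Hpolar) (D_convex : convex D)
  (f_polar_analytic : polar_analytic D f)
  (gamma_closed_regular : closed_regular_curve gamma a b)
  (gamma_in_D : contained (trace gamma a b) D)
  (U_domain : is_domain U) (U_convex : convex U) (U_sub_D : contained U D)
  (gamma_boundary : forall p, trace gamma a b p <-> boundary U p)
  (gamma_positive : positively_oriented gamma a b U)
  (p0_in_U : U p0) :
  let F := fun p : R * R =>
    (polar_power (c - 1) p * f p * cis (snd p) /
     ((ln (fst p / fst p0))%R + Ci * (snd p - snd p0)%R) ^ (k + 1))%C in
  (/ (2 * PI * Ci) *
     line_integral gamma a b F (fun p => Ci * fst p * F p)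
   = polar_power c p0 * (Theta c k f p0 / INR (fact k)))%C.
Proof.
  intros F.
  destruct D_domain as [_ [D_open _]]. destruct U_domain as [_ [U_open _]].
  destruct gamma_closed_regular as [lt_ab [G1 [G2 [gamma_closed _]]]].
  pose proof (piecewise_path_of_coords gamma a b (piecewise_C1_coord _ _ _ G1)
    (piecewise_C1_coord _ _ _ G2)) as path.
  assert (gamma_D : forall t, a <= t <= b -> D (gamma t)).
  { intros t Ht. apply gamma_in_D. now exists t. }
  assert (gamma_U : forall t, a <= t <= b -> ~ U (gamma t)).
  { intros t Ht. apply boundary_of_open; [easy|]. apply gamma_boundary. now exists t. }
  assert (U_pos : forall z, U z -> 0 < fst z) by (intros z Hz; apply D_sub_H, U_sub_D, Hz).
  set (h := fun p => (polar_power c p * f p)%C).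
  assert (h_diff : forall z, D z -> exists l, cdiff Llog h z l).
  { intros z Hz. destruct (f_polar_analytic z Hz) as [l Hl].
    pose proof (D_sub_H z Hz : 0 < fst z) as z0.
    eexists. apply cdiff_mult; [now apply Llog_continuous|now apply cdiff_polar_power|].
    apply cdiff_log_of_polar; [easy|]. apply is_Dpol_iff; eauto. }
  assert (pi0 : (2 * PI * Ci)%C <> 0).
  { intros E. apply (f_equal snd) in E. simpl in E. pose proof PI_RGT_0. lra. }
  (* The n-th [Llog]-derivative of h carries the kernel to the power n + 1, whence [S n]; each
     differentiation brings down a factor n + 1, absorbed by the factorial. *)
  set (G := fun n p => (INR (fact n) / (2 * PI * Ci) * cauchy_integral gamma a b h (S n) p)%C).
  assert (G_0 : forall p, U p -> G O p = h p).
  { intros p Hp.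
    pose proof (cauchy_formula D U gamma a b h D_open D_convex D_sub_H path gamma_closed gamma_D
      U_open U_sub_D gamma_U gamma_positive h_diff p Hp) as I.
    unfold G, cauchy_integral.
    rewrite (is_CInt_unique _ a b (2 * PI * Ci * h p)%C).
    - simpl. field. repeat split; intros Z; apply pi0; rewrite Z; ring.
    - revert I. apply is_CInt_ext; [lra|]. intros t Ht. now rewrite Cpow_1_r. }
  assert (G_S : forall n p, U p -> cdiff Llog (G n) p (G (S n) p)).
  { intros n p Hp. unfold G.
    replace (INR (fact (S n)) / (2 * PI * Ci) * cauchy_integral gamma a b h (S (S n)) p)%C
      with (INR (fact n) / (2 * PI * Ci) * (INR (S n) * cauchy_integral gamma a b h (S (S n)) p))%C.
    - apply cdiff_scal; [apply Llog_continuous; auto|].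
      now apply (cdiff_cauchy_integral D U).
    - change (fact (S n)) with (S n * fact n)%nat. rewrite mult_INR, RtoC_mult.
      field. repeat split; intros Z; apply pi0; rewrite Z; ring. }
  assert (power_inv : forall p, (polar_power c p * polar_power (- c) p)%C = 1).
  { intros p. rewrite <- polar_power_plus. replace (c + - c) with 0 by ring. apply polar_power_0. }
  (* Removing the factor z^c, with z = r e^{i theta}, turns d/dLlog into the polar Mellin
     derivative: dE_n/dLlog = E_{n+1} - c E_n, and E_0 = f on U. *)
  set (E := fun n p => (polar_power (- c) p * G n p)%C).
  assert (Th : Theta c k f p0 = E k p0).
  { apply (Theta_iterate U f c E); try easy.
    - intros p Hp. unfold E. rewrite G_0 by easy. unfold h.
      replace (polar_power (- c) p * (polar_power c p * f p))%C
        with (polar_power c p * polar_power (- c) p * f p)%C by ring.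
      rewrite power_inv. ring.
    - intros n p Hp. unfold E.
      replace (polar_power (- c) p * G (S n) p - c * (polar_power (- c) p * G n p))%C
        with ((- c)%R * polar_power (- c) p * G n p + polar_power (- c) p * G (S n) p)%C
        by (rewrite RtoC_opp; ring).
      apply cdiff_mult; [apply Llog_continuous; auto|apply cdiff_polar_power; auto|auto]. }
  assert (I : line_integral gamma a b F (fun p => Ci * fst p * F p)%C
              = cauchy_integral gamma a b h (S k) p0).
  { apply is_CInt_unique.
    pose proof (is_CInt_cauchy_integral D U gamma a b h D_sub_H path gamma_D
      U_open U_sub_D gamma_U h_diff (S k) p0 p0_in_U) as I.
    revert I. apply is_CInt_ext; [lra|]. intros t Ht.
    rewrite <- (log_velocity_form gamma (fun q => h q * / (Llog q - Llog p0) ^ S k)%C).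
    pose proof (D_sub_H _ (gamma_D t Ht) : 0 < fst (gamma t)) as r0.
    pose proof (U_pos _ p0_in_U) as r00.
    set (z := gamma t) in *.
    (* Since (r e^{i theta})^{c-1} e^{i theta} = (r e^{i theta})^c / r, the form F (dr + i r dtheta)
       is h (dr / r + i dtheta) over the kernel, that is h dLlog over it. *)
    assert (EF : F z = (h z * / (Llog z - Llog p0) ^ S k * (/ fst z)%R)%C).
    { unfold F, h. rewrite Nat.add_1_r.
      replace ((ln (fst z / fst p0))%R + Ci * (snd z - snd p0)%R)%C with (Llog z - Llog p0)%C.
      2:{ unfold Rdiv. rewrite ln_mult, ln_Rinv by (try apply Rinv_0_lt_compat; easy).
          apply injective_projections; simpl; ring. }
      assert (Ez : polar_power c z = (polar_power (c - 1) z * (fst z * cis (snd z)))%C).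
      { replace c with (c - 1 + 1) at 1 by ring. rewrite polar_power_plus.
        rewrite <- polar_point_power by easy. easy. }
      rewrite Ez, RtoC_inv by lra. field. split.
      - intros K. apply RtoC_inj in K. lra.
      - apply Cpow_nz. apply (Llog_neq D U gamma a b); easy. }
    unfold line_integrand. fold z. rewrite EF. unfold log_dr, log_dtheta.
    rewrite RtoC_inv by lra. field. split.
    - intros K. apply RtoC_inj in K. lra.
    - apply Cpow_nz. apply (Llog_neq D U gamma a b); easy. }
  rewrite I, Th. unfold E.
  replace (polar_power c p0 * (polar_power (- c) p0 * G k p0 / INR (fact k)))%C
    with (polar_power c p0 * polar_power (- c) p0 * (G k p0 / INR (fact k)))%C by (unfold Cdiv; ring).
  rewrite power_inv. unfold G. field. repeat split.
  all: try (intros Z; apply pi0; rewrite Z; ring).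
  intros K. apply RtoC_inj in K. revert K. apply INR_fact_neq_0.
Qed.
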